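(* Let $A$ be a bounded normal operator on $\mathcal{H}$, and let $\mu$ be its scalar spectral measure. (a) If $\mu(\mathbb{C}\setminus\overline{\mathbb{D}}_1)=0$ and $\mu|_{S_1}$ is absolutely continuous with respect to arc length measure on $S_1$, then there exists a countable set $\mathcal{G}\subset\mathcal{H}$ such that $\{A^n g\}_{g\in\mathcal{G},\,n\ge0}$ is a complete Bessel system. (b) If $\mu(\mathbb{C}\setminus\mathbb{D}_1)=0$, then there exists a countable set $\mathcal{G}\subset\mathcal{H}$ such that $\{A^n g\}_{g\in\mathcal{G},\,n\ge0}$ is a Parseval frame for $\mathcal{H}$.
   Context: $\mathcal{H}$ is an infinite-dimensional separable complex Hilbert space. $\mathbb{D}_1$ is the open unit disk in $\mathbb{C}$, $\overline{\mathbb{D}}_1$ its closure, $S_1=\overline{\mathbb{D}}_1\setminus\mathbb{D}_1$ the unit circle. Systems are families indexed by pairs $(g,n)$. A family $\{f_i\}_{i\in I}$ is complete if its closed linear span is $\mathcal{H}$; Bessel if there is $\beta\ge0$ with $\sum_i|\langle f,f_i\rangle|^2\le\beta\|f\|^2$ for all $f\in\mathcal{H}$; a frame if there are $\alpha,\beta>0$ with $\alpha\|f\|^2\le\sum_i|\langle f,f_i\rangle|^2\le\beta\|f\|^2$ for all $f\in\mathcal{H}$; in the paper's terminology it is a Parseval frame if this holds with $\alpha=\beta$. Scalar spectral measure: by the spectral theorem with multiplicity, there are mutually singular compactly supported non-negative Borel measures $\mu_j$ on $\mathbb{C}$, $j\in\{1,2,\dots\}\cup\{\infty\}$, such that $A$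 is unitarily equivalent to $N^{(\infty)}_{\mu_\infty}\oplus N_{\mu_1}\oplus N^{(2)}_{\mu_2}\oplus\cdots$, where $N_{\mu_j}$ is multiplication by $z$ on $L^2(\mu_j)$ and $N^{(j)}_{\mu_j}$ is the direct sum of $j$ copies of it. The scalar spectral measure is $\mu=\sum_{1\le j\le\infty}\mu_j$ (well defined up to mutual absolute continuity). *)

(* Defs.v *)
From HB Require Import structures.
From mathcomp Require Import all_boot all_order all_algebra.
From mathcomp Require Import sesquilinear complex.
From mathcomp Require Import all_classical all_reals all_analysis.
Set Implicit Arguments.
Unset Strict Implicit.
Unset Printing Implicit Defensive.
Import Order.TTheory GRing.Theory Num.Theory numFieldNormedType.Exports.

Local Open Scope classical_set_scope.
Local Open Scope complex_scope.
Local Open Scope ring_scope.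

(** ** Hilbert spaces *)

(* Norms over [R[i]] take their (real) values in [R[i]]; [rnorm] reads them in
   [R].  It also gives the modulus of a complex number. *)
Definition rnorm (R : realType) (V : normedZmodType R[i]) (x : V) : R :=
  complex.Re `|x|.

(* The norm of the Banach space [H] is the one of the inner product [dot],
   which is linear in its first argument. *)
Definition hilbert_norm (R : realType) (H : completeNormedModType R[i])
    (dot : {dot H for Num.conj}) : Prop :=
  forall f : H, `|f| ^+ 2 = dot f f.

Definition linear_span (K : numFieldType) (V : lmodType K) (S : set V) : set V :=
  [set x | exists (n : nat) (c : 'I_n -> K) (v : 'I_n -> V),
     (forall i, S (v i)) /\ x = \sum_(i < n) c i *: v i].

Definition infinite_dimensional (K : numFieldType) (V : lmodType K) : Prop :=
  ~ exists2 S : set V, finite_set S & linear_span S = setT.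

Definition separable_space (T : topologicalType) : Prop :=
  exists2 D : set T, countable D & dense D.

(** ** Operators *)

Definition bounded_operator (R : realType) (H : completeNormedModType R[i])
    (A : {linear H -> H}) : Prop :=
  exists M : R, forall f : H, rnorm (A f) <= M * rnorm f.

Definition is_adjoint (R : realType) (H : completeNormedModType R[i])
    (dot : {dot H for Num.conj}) (A B : H -> H) : Prop :=
  forall f g : H, dot (A f) g = dot f (B g).

Definition normal_operator (R : realType) (H : completeNormedModType R[i])
    (dot : {dot H for Num.conj}) (A : {linear H -> H}) : Prop :=
  exists2 B : H -> H, is_adjoint dot A B & forall f, A (B f) = B (A f).

(** ** Families of vectors

   A family is a map [F : T -> H] restricted to an index set [I : set T]. *)

Definition complete_family (R : realType) (H : completeNormedModType R[i])
    (T : choiceType) (I : set T) (F : T -> H) : Prop :=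
  closure (linear_span (F @` I)) = setT.

Definition coef_sum (R : realType) (H : completeNormedModType R[i])
    (dot : {dot H for Num.conj}) (T : choiceType) (I : set T) (F : T -> H)
    (f : H) : \bar R :=
  (\esum_(i in I) ((rnorm (dot f (F i)) ^+ 2)%:E))%E.

Definition bessel (R : realType) (H : completeNormedModType R[i])
    (dot : {dot H for Num.conj}) (T : choiceType) (I : set T) (F : T -> H) :
    Prop :=
  exists2 beta : R, 0 <= beta &
    forall f : H, (coef_sum dot I F f <= (beta * rnorm f ^+ 2)%:E)%E.

Definition frame_with_bounds (R : realType) (H : completeNormedModType R[i])
    (dot : {dot H for Num.conj}) (T : choiceType) (I : set T) (F : T -> H)
    (alpha beta : R) : Prop :=
  [/\ 0 < alpha, 0 < beta & forall f : H,
    ((alpha * rnorm f ^+ 2)%:E <= coef_sum dot I F f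
      <= (beta * rnorm f ^+ 2)%:E)%E].

(* The frame bounds are equal but not required to be 1. *)
Definition parseval_frame (R : realType) (H : completeNormedModType R[i])
    (dot : {dot H for Num.conj}) (T : choiceType) (I : set T) (F : T -> H) :
    Prop :=
  exists alpha beta : R, alpha = beta /\ frame_with_bounds dot I F alpha beta.

Definition orbit_index (T : Type) (G : set T) : set (T * nat) :=
  G `*` [set: nat].

Definition orbit_family (T : Type) (A : T -> T) (p : T * nat) : T :=
  iter p.2 A p.1.

(** ** Measures on the complex plane *)

(* The topology of the complex plane is carried by [R[i]^o]. *)
Definition borelC (R : realType) : Type :=
  g_sigma_algebraType (@open R[i]^o).
HB.instance Definition _ (R : realType) := Measurable.on (borelC R).

Definition unit_disk (R : realType) : set (borelC R) :=
  [set z : R[i] | `|z| < 1].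
Arguments unit_disk : clear implicits.

Definition closed_unit_disk (R : realType) : set (borelC R) :=
  closure (unit_disk R : set R[i]^o).
Arguments closed_unit_disk : clear implicits.

Definition unit_circle (R : realType) : set (borelC R) :=
  closed_unit_disk R `\` unit_disk R.
Arguments unit_circle : clear implicits.

Definition circle_param (R : realType) (t : R) : borelC R :=
  cos t +i* sin t.

Definition arc_length (R : realType) : set (borelC R) -> \bar R :=
  pushforward
    (mrestr (@lebesgue_measure R) (measurable_itv `[(0 : R), 2 * pi[))
    (@circle_param R).
Arguments arc_length : clear implicits.

Definition compactly_supported (R : realType)
    (mu : {measure set (borelC R) -> \bar R}) : Prop :=
  exists2 K : set R[i]^o, compact K & mu (~` K) = 0%E.

Definition mutually_singular (R : realType)
    (mu nu : {measure set (borelC R) -> \bar R}) : Prop :=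
  exists2 E : set (borelC R), measurable E & mu E = 0%E /\ nu (~` E) = 0%E.

(** ** The multiplication model of a normal operator

   Multiplicities in {1, 2, ...} \cup {oo} are encoded by [option nat]:
   [Some m] is m + 1 and [None] is oo.  The pair [(j, k)] indexes the k-th copy
   of [L^2(mu_j)], copies being counted from 0. *)

Definition copy_index : set (option nat * nat) :=
  [set p | if p.1 is Some m then (p.2 < m.+1)%N else True].

(* Vectors of the direct sum are represented by families of functions, and
   [model_eq] is equality of the corresponding classes. *)
Definition model_sqnorm (R : realType)
    (mu : option nat -> {finite_measure set (borelC R) -> \bar R})
    (F : option nat * nat -> borelC R -> borelC R) : \bar R :=
  (\esum_(p in copy_index)
     \int[mu p.1]_z ((rnorm (F p z : R[i]) ^+ 2)%:E))%E.

Definition in_model (R : realType)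
    (mu : option nat -> {finite_measure set (borelC R) -> \bar R})
    (F : option nat * nat -> borelC R -> borelC R) : Prop :=
  (forall p, copy_index p -> measurable_fun setT (F p)) /\
  (model_sqnorm mu F < +oo)%E.

Definition model_eq (R : realType)
    (mu : option nat -> {finite_measure set (borelC R) -> \bar R})
    (F G : option nat * nat -> borelC R -> borelC R) : Prop :=
  forall p, copy_index p -> {ae mu p.1, forall z, F p z = G p z}.

(* A unitary operator, i.e. a surjective linear isometry, from [H] onto the
   direct sum. *)
Definition unitary_to_model (R : realType) (H : completeNormedModType R[i])
    (mu : option nat -> {finite_measure set (borelC R) -> \bar R})
    (U : H -> option nat * nat -> borelC R -> borelC R) : Prop :=
  [/\ forall f, in_model mu (U f),
      forall (a : R[i]) (f g : H),
        model_eq mu (U (a *: f + g))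
          (fun p z => a * (U f p z : R[i]) + (U g p z : R[i])),
      forall f, model_sqnorm mu (U f) = (rnorm f ^+ 2)%:E
    & forall F, in_model mu F -> exists f, model_eq mu (U f) F].

Definition mul_by_z (R : realType)
    (F : option nat * nat -> borelC R -> borelC R) :
    option nat * nat -> borelC R -> borelC R :=
  fun p z => (z : R[i]) * (F p z : R[i]).

(* The measures [mu_ j] are finite, as compactly supported Radon measures are. *)
Definition scalar_spectral_measure (R : realType)
    (H : completeNormedModType R[i]) (A : {linear H -> H})
    (mu : {measure set (borelC R) -> \bar R}) : Prop :=
  exists (mu_ : option nat -> {finite_measure set (borelC R) -> \bar R})
         (U : H -> option nat * nat -> borelC R -> borelC R),
  [/\ forall j, compactly_supported (mu_ j),
      forall j k, j != k -> mutually_singular (mu_ j) (mu_ k),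
      unitary_to_model mu_ U,
      forall f, model_eq mu_ (U (A f)) (mul_by_z (U f))
    & forall B, measurable B -> mu B = (\esum_(j in [set: option nat]) mu_ j B)%E].

(* Main.v *)
Require Import Defs.
From HB Require Import structures.
From mathcomp Require Import all_boot all_order all_algebra.
From mathcomp Require Import sesquilinear complex finmap.
From mathcomp Require Import all_classical all_reals all_analysis.
From mathcomp Require Import measurable_realfun.
From mathcomp Require Import ring lra.
Import Order.TTheory GRing.Theory Num.Theory numFieldNormedType.Exports.

(** The spectral theorem turns both statements into estimates on measures in the
    plane. Let [f] be a vector and let [m_f] be the finite measure
    [B |-> sum_p int_B |(U f)_p|^2 dmu_p], where [U] is the unitary map onto the
    multiplication model. Then [|psi(A) f|^2] is the integral of [|psi|^2] for
    [m_f], for polynomials and for bounded Borel functions [psi]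
    ([spectral_measure_ex]), and [m_f] does not charge the null sets of the
    scalar spectral measure.

    For (b), let [B] be the adjoint of [A] and let [D] be the square root of
    [I - A* A], that is, multiplication by [sqrt (1 - |z|^2)]. It is
    self-adjoint and [|D f|^2 = |f|^2 - |A f|^2]. If [(e_k)] is an orthonormal
    basis ([orthonormal_basis]), then for each [n]
    [sum_k |<f, A^n D e_k>|^2 = |D B^n f|^2 = |B^n f|^2 - |B^(n+1) f|^2],
    which telescopes over [n] to [|f|^2] minus the limit of [|A^n f|^2]. This
    limit is 0 by dominated convergence because [m_f] is carried by the open
    disk. So the [D e_k] generate a Parseval frame ([parseval_orbits]).

    For (a), it is enough that the vectors whose orbit is a Bessel system be
    dense: countably many of them have a dense span, and multiplying each one by
    a small positive number makes the Bessel bounds summable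
    ([complete_bessel_orbits]). By duality the orbit of [g] is Bessel if
    [|sum_n a_n A^n g|^2] is at most a constant times [sum_n |a_n|^2]. Let [g] be
    [1_S(A) f], where [S] is the union of a disk of radius less than 1 and of a
    Borel part of the circle where [m_f] is at most a multiple of arc length.
    The left side is then [int_S |sum_n a_n z^n|^2 dm_f]. The estimate holds on
    the disk by comparison with a geometric series and on the circle by the
    orthogonality of the exponentials ([integral_trig_poly]). By the
    Radon-Nikodym theorem such sets [S] exhaust [m_f] ([bessel_exhaustion]), so
    these vectors [g] approximate [f]. *)

Local Open Scope classical_set_scope.
Local Open Scope ring_scope.
Set Implicit Arguments.
Unset Strict Implicit.
Unset Printing Implicit Defensive.

(** * Hilbert space geometry and orthonormal bases *)
Lemma rnorm_eq (R : realType) (V : normedZmodType R[i]) (x : V) :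
  (rnorm x)%:C%C = `|x|.
Proof. by rewrite /rnorm RRe_real// normr_real. Qed.

Lemma rnorm_ge0 (R : realType) (V : normedZmodType R[i]) (x : V) : 0 <= rnorm x.
Proof. by rewrite -ler0c rnorm_eq. Qed.

Lemma sqr_rnorm_complex (R : realType) (z : R[i]) :
  rnorm z ^+ 2 = complex.Re z ^+ 2 + complex.Im z ^+ 2.
Proof.
by apply: complexI; rewrite add_Re2_Im2 rmorphXn /= rnorm_eq.
Qed.

Lemma rnormM (R : realType) (z w : R[i]) : rnorm (z * w) = rnorm z * rnorm w.
Proof. by apply: complexI; rewrite rmorphM/= !rnorm_eq normrM. Qed.

Lemma rnormX (R : realType) (z : R[i]) n : rnorm (z ^+ n) = rnorm z ^+ n.
Proof. by apply: complexI; rewrite rmorphXn/= !rnorm_eq normrX. Qed.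

Lemma rnorm0 (R : realType) (V : normedZmodType R[i]) : rnorm (0 : V) = 0.
Proof. by apply: complexI; rewrite rnorm_eq normr0. Qed.

Lemma rnorm_eq0 (R : realType) (V : normedZmodType R[i]) (x : V) :
  rnorm x = 0 -> x = 0.
Proof.
by move=> x0; apply/eqP; rewrite -normr_eq0 -rnorm_eq x0.
Qed.

Lemma ler_rnormD (R : realType) (V : normedZmodType R[i]) (x y : V) :
  rnorm (x + y) <= rnorm x + rnorm y.
Proof. by rewrite -lecR rmorphD/= !rnorm_eq ler_normD. Qed.

Lemma rnorm_real (R : realType) (r : R) : rnorm (r%:C%C : R[i]) = `|r|.
Proof.
apply/eqP; rewrite -(eqrXn2 (ltn0Sn 1)) ?rnorm_ge0// sqr_rnorm_complex/=.
by rewrite expr0n addr0 real_normK// num_real.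
Qed.

Section hilbert.
Context (R : realType) (H : completeNormedModType R[i]).
Variable dot : {dot H for Num.conj}.
Hypothesis H_norm : hilbert_norm dot.

(** The real part of the inner product, the form recovered by polarization. *)
Definition redot (f g : H) : R := complex.Re (dot f g).

Lemma sqr_rnormE f : rnorm f ^+ 2 = redot f f.
Proof. by rewrite /redot -H_norm -rnorm_eq -rmorphXn. Qed.

Lemma dotC f g : dot f g = (dot g f)^*%C.
Proof. by rewrite (hermC dot) expr0 mul1r. Qed.

Lemma redotC f g : redot f g = redot g f.
Proof. by rewrite /redot dotC; case: (dot g f). Qed.

Lemma dotDl f g h : dot (f + g) h = dot f h + dot g h.
Proof. exact: linearDl. Qed.

Lemma dotDr h f g : dot h (f + g) = dot h f + dot h g.
Proof. exact: linearD. Qed.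

Lemma dotZl c f h : dot (c *: f) h = c * dot f h.
Proof. exact: linearZl_LR. Qed.

Lemma dotZr c f h : dot h (c *: f) = c^*%C * dot h f.
Proof. exact: linearZ. Qed.

Lemma dotNl f h : dot (- f) h = - dot f h.
Proof. exact: linearNl. Qed.

Lemma dotNr h f : dot h (- f) = - dot h f.
Proof. exact: linearN. Qed.

Lemma dot0l h : dot 0 h = 0.
Proof. exact: linear0l. Qed.

Lemma dot_suml (I : Type) (r : seq I) (P : pred I) (F : I -> H) h :
  dot (\sum_(i <- r | P i) F i) h = \sum_(i <- r | P i) dot (F i) h.
Proof. by apply: (big_morph (dot^~ h)) => [f g|]; rewrite ?dotDl ?dot0l. Qed.

Lemma dot_sumr (I : Type) (r : seq I) (P : pred I) (F : I -> H) h :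
  dot h (\sum_(i <- r | P i) F i) = \sum_(i <- r | P i) dot h (F i).
Proof. exact: linear_sum. Qed.

Lemma dot_self f : dot f f = (rnorm f ^+ 2)%:C%C.
Proof. by rewrite -H_norm -rnorm_eq rmorphXn. Qed.

Lemma sqr_rnormD f g :
  rnorm (f + g) ^+ 2 = rnorm f ^+ 2 + 2 * redot f g + rnorm g ^+ 2.
Proof.
rewrite !sqr_rnormE {1}/redot dotDl !dotDr !raddfD/=.
by rewrite -/(redot _ _) -!/(redot _ _) (redotC g f); ring.
Qed.

Lemma redotN f g : redot f (- g) = - redot f g.
Proof. by rewrite /redot dotNr raddfN. Qed.

Lemma sqr_rnormB f g :
  rnorm (f - g) ^+ 2 = rnorm f ^+ 2 - 2 * redot f g + rnorm g ^+ 2.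
Proof.
rewrite sqr_rnormD redotN; congr (_ + _ + _); first by rewrite mulrN.
by rewrite /rnorm normrN.
Qed.

Lemma rnormZ (c : R[i]) (f : H) : rnorm (c *: f) = rnorm c * rnorm f.
Proof. by apply: complexI; rewrite rmorphM/= !rnorm_eq normrZ. Qed.

Section orthogonal_projection.
Variable e : nat -> H.

(** The Fourier partial sum of [f] along [e_0, ..., e_(n-1)]; it is the
    orthogonal projection onto their span when the nonzero [e_k] are
    orthonormal. Zero vectors are allowed among the [e_k], which spares a case
    distinction on linear dependence in the Gram-Schmidt process. *)
Definition oproj (n : nat) (f : H) : H := \sum_(k < n) dot f (e k) *: e k.

Lemma oproj_ortho n f :
  (forall i j, (i < n)%N -> (j < n)%N -> i != j -> dot (e i) (e j) = 0) ->
  (forall i, (i < n)%N -> e i = 0 \/ rnorm (e i) = 1) ->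
  forall j, (j < n)%N -> dot (f - oproj n f) (e j) = 0.
Proof.
move=> orth unit j jn; rewrite dotDl dotNl dot_suml (bigD1 (Ordinal jn))//=.
rewrite big1 => [|i ij]; last first.
  by rewrite dotZl orth ?mulr0//; exact: ij.
rewrite addr0 dotZl; case: (unit j jn) => [->|ej1].
  by rewrite linear0 mul0r subr0.
by rewrite dot_self ej1 expr1n mulr1 subrr.
Qed.

Hypothesis orth : forall i j, i != j -> dot (e i) (e j) = 0.
Hypothesis unit : forall i, e i = 0 \/ rnorm (e i) = 1.

Lemma sqr_rnorm_oproj n f :
  rnorm (oproj n f) ^+ 2 = \sum_(k < n) rnorm (dot f (e k)) ^+ 2.
Proof.
apply: complexI; rewrite -dot_self rmorph_sum/= /oproj dot_suml.
apply: eq_bigr => i _; rewrite dotZl dot_sumr (bigD1 i)//= big1 => [|j ji].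
  rewrite addr0 dotZr; case: (unit i) => [->|ei1].
    by rewrite linear0 mul0r rnorm0 expr0n.
  by rewrite dot_self ei1 expr1n mulr1 rmorphXn/= rnorm_eq normCK.
by rewrite dotZr orth ?mulr0// eq_sym.
Qed.

(** Pythagoras: among the combinations of [e_0, ..., e_(n-1)] the projection is
    the one closest to [f]. *)
Lemma sqr_rnormB_comb n f (c : 'I_n -> R[i]) :
  rnorm (f - \sum_(k < n) c k *: e k) ^+ 2 =
  rnorm f ^+ 2 - \sum_(k < n) rnorm (dot f (e k)) ^+ 2
  + rnorm (oproj n f - \sum_(k < n) c k *: e k) ^+ 2.
Proof.
have rt g : (forall j, (j < n)%N -> dot g (e j) = 0) ->
  forall b : 'I_n -> R[i], dot g (\sum_(k < n) b k *: e k) = 0.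
  by move=> g0 b; rewrite dot_sumr big1// => i _; rewrite dotZr g0 ?mulr0.
have fo : forall j, (j < n)%N -> dot (f - oproj n f) (e j) = 0.
  by apply: oproj_ortho => *; [exact: orth|exact: unit].
have -> : f - \sum_(k < n) c k *: e k =
    (f - oproj n f) + (oproj n f - \sum_(k < n) c k *: e k).
  by rewrite addrA subrK.
have po h : dot (f - oproj n f) (oproj n h) = 0 by exact: rt.
rewrite sqr_rnormD /redot dotDr dotNr rt// po subr0/= mulr0 addr0.
congr (_ + _); rewrite -sqr_rnorm_oproj.
have := sqr_rnormD (f - oproj n f) (oproj n f).
by rewrite subrK /redot po/= mulr0 addr0 => ->; rewrite addrK.
Qed.

Lemma bessel_inequality n f :
  \sum_(k < n) rnorm (dot f (e k)) ^+ 2 <= rnorm f ^+ 2.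
Proof.
rewrite -subr_ge0; have := sqr_rnormB_comb f (fun k : 'I_n => dot f (e k)).
by rewrite subrr rnorm0 expr0n addr0 => <-; rewrite sqr_ge0.
Qed.

End orthogonal_projection.

Section gram_schmidt.
Variable d : nat -> H.

(** The unit vector in the direction of [x]; it is 0 when [x] is 0. *)
Definition normalize (x : H) : H := ((rnorm x)^-1)%:C%C *: x.

Lemma normalizeK x : (rnorm x)%:C%C *: normalize x = x.
Proof.
rewrite /normalize scalerA -rmorphM/=.
have [x0|x0] := eqVneq (rnorm x) 0; last by rewrite mulfV// scale1r.
by rewrite (rnorm_eq0 x0) scaler0.
Qed.

Lemma rnorm_normalize x : normalize x = 0 \/ rnorm (normalize x) = 1.
Proof.
have [x0|x0] := eqVneq (rnorm x) 0.
  by left; rewrite /normalize (rnorm_eq0 x0) scaler0.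
right; rewrite rnormZ rnorm_real ger0_norm ?invr_ge0 ?rnorm_ge0//.
by rewrite mulVf.
Qed.

(** The list of the first [n] vectors of the Gram-Schmidt process applied to [d];
    the value is 0 at the steps where [d] brings no new direction. *)
Fixpoint gs_seq (n : nat) : seq H :=
  if n is m.+1 then
    rcons (gs_seq m) (normalize (d m - oproj (nth 0 (gs_seq m)) m (d m)))
  else [::].

(** The [n]-th Gram-Schmidt vector. *)
Definition gs (n : nat) : H := nth 0 (gs_seq n.+1) n.

Lemma size_gs_seq n : size (gs_seq n) = n.
Proof. by elim: n => //= n IH; rewrite size_rcons IH. Qed.

Lemma nth_gs_seq m n : (n < m)%N -> nth 0 (gs_seq m) n = gs n.
Proof.
elim: m => // m IH; rewrite ltnS leq_eqVlt => /predU1P[->//|nm].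
by rewrite [LHS]/= nth_rcons size_gs_seq nm IH.
Qed.

Lemma gsE n : gs n = normalize (d n - oproj gs n (d n)).
Proof.
rewrite {1}/gs /= nth_rcons size_gs_seq ltnn eqxx; congr (normalize (_ - _)).
by apply: eq_bigr => i _; rewrite nth_gs_seq.
Qed.

Lemma gs_unit n : gs n = 0 \/ rnorm (gs n) = 1.
Proof. by rewrite gsE; exact: rnorm_normalize. Qed.

Lemma gs_orth i j : i != j -> dot (gs i) (gs j) = 0.
Proof.
suff gs_orth_lt n : forall k l, (k < n)%N -> (l < n)%N -> k != l ->
    dot (gs k) (gs l) = 0.
  by move=> ij; apply: (gs_orth_lt (maxn i j).+1); rewrite // ltnS leq_max leqnn ?orbT.
elim: n => // n IH k l.
have on m : (m < n)%N -> dot (gs n) (gs m) = 0.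
  move=> mn; rewrite gsE dotZl oproj_ortho ?mulr0//.
  by move=> *; exact: gs_unit.
rewrite !ltnS leq_eqVlt => /predU1P[->|kn]; rewrite leq_eqVlt => /predU1P[->|ln].
- by rewrite eqxx.
- by move=> _; exact: on.
- by move=> _; rewrite dotC on// rmorph0.
- exact: IH.
Qed.

(** The span of the Gram-Schmidt vectors contains the original sequence. *)
Lemma gs_decomp n :
  exists c : 'I_n.+1 -> R[i], d n = \sum_(k < n.+1) c k *: gs k.
Proof.
exists (fun k => if (k < n)%N then dot (d n) (gs k)
                 else (rnorm (d n - oproj gs n (d n)))%:C%C).
rewrite big_ord_recr/= ltnn gsE normalizeK.
under eq_bigr do rewrite ltn_ord.
by rewrite addrC subrK.
Qed.

End gram_schmidt.

Lemma separable_sequence : separable_space H ->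
  exists d : nat -> H, forall (f : H) (eps : R), 0 < eps ->
    exists n, rnorm (f - d n) < eps.
Proof.
move=> [D /countable_injP[c c_inj] Ddense].
exists (fun n => xget 0 [set x | D x /\ c x = n]) => f eps eps0.
have epsC : (0 : R[i]) < eps%:C%C by rewrite -ltcR in eps0.
have [] := Ddense (ball f eps%:C%C) _ _.
- by exists f; exact: ballxx.
- exact: ball_open.
move=> x [fx Dx]; exists (c x).
case: xgetP => [y _ [Dy cyx]|/(_ x)]; last by move=> /not_andP[].
rewrite (c_inj _ _ _ _ cyx) ?inE//.
by move: fx; rewrite -ball_normE/= -rnorm_eq ltcR.
Qed.

(** A separable Hilbert space has a countable orthonormal basis, indexed here by
    all natural numbers with some entries possibly 0. Parseval's identity
    follows from Bessel's inequality and the density of the sequence to which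
    Gram-Schmidt is applied, the projections being at least as good as the
    members of that sequence. *)
Lemma orthonormal_basis : separable_space H ->
  exists e : nat -> H,
    [/\ forall i j, i != j -> dot (e i) (e j) = 0,
        forall i, e i = 0 \/ rnorm (e i) = 1
      & forall f, (\sum_(k <oo) (rnorm (dot f (e k)) ^+ 2)%:E =
                   (rnorm f ^+ 2)%:E)%E].
Proof.
move=> /separable_sequence[d ddense]; exists (gs d).
split; [exact: gs_orth|exact: gs_unit|move=> f].
have orth := @gs_orth d; have unit := gs_unit d.
apply/eqP; rewrite eq_le; apply/andP; split.
  apply: lime_le; first by apply: is_cvg_nneseries => *; rewrite lee_fin sqr_ge0.
  apply: nearW => n; rewrite /= sumEFin lee_fin big_mkord.
  exact: bessel_inequality.
apply/lee_addgt0Pr => eps eps0.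
have [|n fn] := ddense f (Num.sqrt eps); first by rewrite sqrtr_gt0.
have [c dn] := gs_decomp d n.
have := sqr_rnormB_comb orth unit f c; rewrite -dn.
have fn2 : rnorm (f - d n) ^+ 2 <= eps.
  by rewrite -(sqr_sqrtr (ltW eps0)) lerXn2r ?nnegrE ?rnorm_ge0 ?sqrtr_ge0 ?ltW.
move=> E.
have {E fn2} fle : rnorm f ^+ 2 <= \sum_(k < n.+1) rnorm (dot f (gs d k)) ^+ 2 + eps.
  rewrite -lerBlDl (le_trans _ fn2)// E lerDl sqr_ge0//.
rewrite (@le_trans _ _ (\sum_(k < n.+1) rnorm (dot f (gs d k)) ^+ 2 + eps)%:E)//.
rewrite EFinD leeD2r// -sumEFin.
rewrite -(big_mkord xpredT (fun k => (rnorm (dot f (gs d k)) ^+ 2)%:E)).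
by apply: nneseries_lim_ge => *; rewrite lee_fin sqr_ge0.
Qed.

End hilbert.

(** * Borel measurability of complex-valued functions *)
Section borel_complex.
Context (R : realType).

Lemma open_complexP (U : set R[i]^o) (z : R[i]) : open U -> U z ->
  exists2 e : R, 0 < e & forall w : R[i], rnorm (w - z) < e -> U w.
Proof.
move=> oU Uz; have /nbhs_ballP[e /= e0 eU] : nbhs (z : R[i]^o) U by exact: open_nbhs_nbhs.
have eR : e = (complex.Re e)%:C%C by rewrite RRe_real// gtr0_real.
exists (complex.Re e); first by rewrite -ltcR -eR.
by move=> w zw; apply: eU; rewrite -ball_normE/= distrC -rnorm_eq eR ltcR.
Qed.

Lemma open_complex (U : set R[i]^o) :
  (forall z, U z -> exists2 e : R, 0 < e &
     forall w : R[i], rnorm (w - z) < e -> U w) -> open U.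
Proof.
move=> oU; rewrite openE => z /oU[e e0 eU]; apply/nbhs_ballP.
exists e%:C%C; first by rewrite /= -ltcR in e0 *.
by move=> w; rewrite -ball_normE/= distrC -rnorm_eq ltcR => /eU.
Qed.

Lemma ler_Re_rnorm (z : R[i]) : `|complex.Re z| <= rnorm z.
Proof.
rewrite -(@ler_pXn2r _ 2) ?nnegrE ?rnorm_ge0// sqr_rnorm_complex.
by rewrite real_normK ?num_real// lerDl sqr_ge0.
Qed.

Lemma ler_Im_rnorm (z : R[i]) : `|complex.Im z| <= rnorm z.
Proof.
rewrite -(@ler_pXn2r _ 2) ?nnegrE ?rnorm_ge0// sqr_rnorm_complex.
by rewrite real_normK ?num_real// lerDr sqr_ge0.
Qed.

Lemma open_borelC (U : set R[i]^o) : open U -> measurable (U : set (borelC R)).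
Proof. by move=> oU; exact: sub_sigma_algebra. Qed.

(** A real function that is 1-Lipschitz for the modulus is Borel. *)
Lemma lipschitz_measurable (f : borelC R -> R) :
  (forall z w : R[i], `|f w - f z| <= rnorm (w - z)) -> measurable_fun setT f.
Proof.
move=> flip; apply: (measurability _ (RGenOInfty.measurableE R)).
move=> _ [_ [x ->] <-]; rewrite setTI; apply: open_borelC.
apply: open_complex => z /=; rewrite in_itv/= andbT => xz.
exists (f z - x); first by rewrite subr_gt0.
move=> w wz; rewrite in_itv/= andbT.
have := le_lt_trans (flip z w) wz.
by rewrite ltr_norml => /andP[+ _]; lra.
Qed.

Lemma measurable_Re : measurable_fun setT (fun z : borelC R => complex.Re (z : R[i])).
Proof.
by apply: lipschitz_measurable => z w; rewrite -raddfB; exact: ler_Re_rnorm.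
Qed.

Lemma measurable_Im : measurable_fun setT (fun z : borelC R => complex.Im (z : R[i])).
Proof.
by apply: lipschitz_measurable => z w; rewrite -raddfB; exact: ler_Im_rnorm.
Qed.

Section measurable_functions.
Context d (T : measurableType d).
Implicit Types f g : T -> borelC R.

Lemma measurable_Re_comp f : measurable_fun setT f ->
  measurable_fun setT (fun x => complex.Re (f x : R[i])).
Proof. exact: measurableT_comp measurable_Re. Qed.

Lemma measurable_Im_comp f : measurable_fun setT f ->
  measurable_fun setT (fun x => complex.Im (f x : R[i])).
Proof. exact: measurableT_comp measurable_Im. Qed.

(** A complex function is Borel as soon as its real and imaginary parts are: an
    open set of the plane is the union of the countably many open rectangles
    with rational vertices that it contains. *)
Lemma measurable_complexP f :
  measurable_fun setT (fun x => complex.Re (f x : R[i])) ->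
  measurable_fun setT (fun x => complex.Im (f x : R[i])) ->
  measurable_fun setT f.
Proof.
move=> mRe mIm; apply: (@measurability _ _ T (borelC R) setT f (@open R[i]^o)) => //.
move=> _ [U oU <-]; rewrite setTI.
pose S (q : (rat * rat) * (rat * rat)) : set R[i] :=
  [set z | ratr q.1.1 < complex.Re z < ratr q.1.2 /\
           ratr q.2.1 < complex.Im z < ratr q.2.2].
pose V q := if `[<S q `<=` U>] then f @^-1` S q else set0.
rewrite [X in measurable X](_ : _ = \bigcup_q V q); last first.
  apply/seteqP; split=> x; last first.
    move=> [q _]; rewrite /V; case: ifPn => // /asboolP SU /=; exact: SU.
  move=> Ufx; have [e e0 eU] := open_complexP oU Ufx.
  have itv (r : R) : exists q : rat * rat, ratr q.1 < r < ratr q.2 /\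
      (ratr q.2 - ratr q.1 : R) < e / 2.
    have [q1] := @rat_in_itvoo R (r - e / 4) r ltac:(lra).
    have [q2] := @rat_in_itvoo R r (r + e / 4) ltac:(lra).
    rewrite !in_itv/= => /andP[h1 h2] /andP[h3 h4].
    by exists (q1, q2); rewrite /= h1 h4; split=> //; lra.
  have [q1 [q1f q1e]] := itv (complex.Re (f x : R[i])).
  have [q2 [q2f q2e]] := itv (complex.Im (f x : R[i])).
  exists (q1, q2) => //; rewrite /V asboolT//= => z [/= zq1 zq2]; apply: eU.
  rewrite -(@ltr_pXn2r _ 2) ?nnegrE ?rnorm_ge0 ?ltW// sqr_rnorm_complex !raddfB/=.
  move: q1f q2f zq1 zq2 => /andP[? ?] /andP[? ?] /andP[? ?] /andP[? ?].
  have sq (a : R) : - (e / 2) < a -> a < e / 2 -> a ^+ 2 < e ^+ 2 / 4.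
    move=> h1 h2; have -> : e ^+ 2 / 4 = (e / 2) ^+ 2 by field.
    by rewrite -real_normK ?num_real// ltrXn2r ?nnegrE// ?ltr_norml ?h1//; lra.
  have := sq (complex.Re z - complex.Re (f x : R[i])) ltac:(lra) ltac:(lra).
  have := sq (complex.Im z - complex.Im (f x : R[i])) ltac:(lra) ltac:(lra).
  by have := exprn_gt0 2 e0; lra.
apply: countable_bigcupT_measurable => // q; rewrite /V; case: ifP => // _.
rewrite (_ : _ @^-1` _ =
  ((fun x => complex.Re (f x : R[i])) @^-1` `]ratr q.1.1, ratr q.1.2[) `&`
  ((fun x => complex.Im (f x : R[i])) @^-1` `]ratr q.2.1, ratr q.2.2[)).
  apply: measurableI; rewrite -[X in measurable X]setTI;
    [exact: mRe|exact: mIm].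
by apply/seteqP; split=> x /=; rewrite !in_itv.
Qed.

Lemma measurable_rnorm2 f : measurable_fun setT f ->
  measurable_fun setT (fun x => rnorm (f x : R[i]) ^+ 2).
Proof.
move=> mf; under eq_fun do rewrite sqr_rnorm_complex.
by apply: measurable_funD; apply: measurable_funX;
  [exact: measurable_Re_comp|exact: measurable_Im_comp].
Qed.

Lemma measurable_rnorm2E f : measurable_fun setT f ->
  measurable_fun setT (fun x => (rnorm (f x : R[i]) ^+ 2)%:E).
Proof. by move=> mf; exact/measurable_EFinP/measurable_rnorm2. Qed.

Lemma measurable_complexD f g : measurable_fun setT f -> measurable_fun setT g ->
  measurable_fun setT (fun x => (f x : R[i]) + (g x : R[i]) : borelC R).
Proof.
move=> mf mg; apply: measurable_complexP; under eq_fun do rewrite raddfD/=;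
  apply: measurable_funD;
  by [exact: measurable_Re_comp|exact: measurable_Im_comp].
Qed.

Lemma measurable_complexM f g : measurable_fun setT f -> measurable_fun setT g ->
  measurable_fun setT (fun x => (f x : R[i]) * (g x : R[i]) : borelC R).
Proof.
have ReM (a b : R[i]) : complex.Re (a * b) =
    complex.Re a * complex.Re b - complex.Im a * complex.Im b.
  by case: a; case: b.
have ImM (a b : R[i]) : complex.Im (a * b) =
    complex.Re a * complex.Im b + complex.Im a * complex.Re b.
  by case: a => ? ?; case: b => ? ? /=; ring.
move=> mf mg; apply: measurable_complexP.
  under eq_fun do rewrite ReM.
  by apply: measurable_funB; apply: measurable_funM;
    (exact: measurable_Re_comp || exact: measurable_Im_comp).
under eq_fun do rewrite ImM.
by apply: measurable_funD; apply: measurable_funM;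
  (exact: measurable_Re_comp || exact: measurable_Im_comp).
Qed.

Lemma measurable_complexX f n : measurable_fun setT f ->
  measurable_fun setT (fun x => (f x : R[i]) ^+ n : borelC R).
Proof.
move=> mf; elim: n => [|n IH]; first exact: measurable_cst.
by under eq_fun do rewrite exprS; exact: measurable_complexM.
Qed.

Lemma measurable_complex_sum n (f : 'I_n -> T -> borelC R) :
  (forall i, measurable_fun setT (f i)) ->
  measurable_fun setT (fun x => \sum_(i < n) (f i x : R[i]) : borelC R).
Proof.
elim: n f => [|n IH] f mf.
  by under eq_fun do rewrite big_ord0; exact: measurable_cst.
under eq_fun do rewrite big_ord_recr/=.
by apply: measurable_complexD; [apply: IH|].
Qed.

Lemma measurable_real_complex (f : T -> R) : measurable_fun setT f ->
  measurable_fun setT (fun x => (f x)%:C%C : borelC R).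
Proof.
by move=> mf; apply: measurable_complexP => //=; exact: measurable_cst.
Qed.

End measurable_functions.

Lemma measurable_complex_poly N (a : nat -> R[i]) :
  measurable_fun setT
    (fun z : borelC R => \sum_(n < N) a n * (z : R[i]) ^+ n : borelC R).
Proof.
apply: measurable_complex_sum => n.
apply: (measurable_complexM (f := fun=> a n)); first exact: measurable_cst.
exact: (measurable_complexX (f := id)).
Qed.

End borel_complex.

(** * Sums of measures with densities *)
Section esum_extra.
Local Open Scope ereal_scope.
Context (R : realType).

(** Tonelli for sums of nonnegative families. *)
Lemma esum_exchange (T1 T2 : choiceType) (I : set T1) (J : set T2)
    (a : T1 -> T2 -> \bar R) :
  (forall i j, I i -> J j -> 0 <= a i j) ->
  \esum_(i in I) \esum_(j in J) a i j = \esum_(j in J) \esum_(i in I) a i j.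
Proof.
move=> a0; rewrite !esum_esum//; last by move=> j i Jj Ii; exact: a0.
rewrite (reindex_esum (J `*`` (fun=> I)) (I `*`` (fun=> J)) (fun k => (k.2, k.1)))//=.
split => /=.
- by move=> [j i] [/= Jj Ii].
- by move=> [j i] [j' i'] _ _ [-> ->].
- by move=> [i j] [/= Ii Jj]; exists (j, i).
Qed.

Lemma esumZl (T : choiceType) (I : set T) (a : T -> \bar R) (c : R) :
  (0 <= c)%R -> (forall i, I i -> 0 <= a i) ->
  \esum_(i in I) (c%:E * a i) = c%:E * \esum_(i in I) a i.
Proof.
have le_esumZ (c' : R) (b : T -> \bar R) : (0 <= c')%R -> (forall i, I i -> 0 <= b i) ->
    \esum_(i in I) (c'%:E * b i) <= c'%:E * \esum_(i in I) b i.
  move=> c0 b0; apply: ge_ereal_sup => _ [X [finX XI] <-].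
  have -> : \sum_(x \in X) (c'%:E * b x) = c'%:E * \sum_(x \in X) b x.
    rewrite !fsbig_finite//= big_seq [in RHS]big_seq ge0_sume_distrr//.
    by move=> i; rewrite in_fset_set// inE => /XI/b0.
  rewrite lee_wpmul2l ?lee_fin//.
  by apply: esum_ge; exists X.
rewrite le_eqVlt => /predU1P[<- _|c0 a0].
  by rewrite mul0e esum1// => i _; rewrite mul0e.
apply/eqP; rewrite eq_le le_esumZ ?(ltW c0)//=.
have := @le_esumZ c^-1%R (fun i => c%:E * a i) _ _.
under eq_esum do rewrite muleA -EFinM mulVf ?gt_eqF// mul1e.
move=> H; rewrite -(@lee_pmul2l _ (c^-1)%:E) ?lte_fin ?invr_gt0//.
rewrite muleA -EFinM mulVf ?gt_eqF// mul1e H ?invr_ge0 ?(ltW c0)// => i Ii.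
by rewrite mule_ge0 ?a0// lee_fin ltW.
Qed.

Lemma subset_esum (T : choiceType) (I J : set T) (a : T -> \bar R) :
  I `<=` J -> (\esum_(i in I) a i <= \esum_(i in J) a i).
Proof.
move=> IJ; apply: ge_ereal_sup => _ [X [finX XI] <-]; apply: esum_ge.
by exists X => //; split=> // i /XI /IJ.
Qed.

Lemma esum_eq0 (T : choiceType) (a : T -> \bar R) :
  (forall i, 0 <= a i) -> (\esum_(i in [set: T]) a i = 0) -> forall i, a i = 0.
Proof.
move=> a0 suma0 i; apply/eqP; rewrite eq_le a0 andbT -suma0; apply: esum_ge.
by exists [set i]; [split|rewrite fsbig_set1].
Qed.

End esum_extra.

Section density_sum.
Import HBNNSimple.
Local Open Scope ereal_scope.
Context d (T : measurableType d) (R : realType) (I : choiceType) (D : set I).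
Variables (mu_ : I -> {measure set T -> \bar R}) (h : I -> T -> R).
Hypothesis h0 : forall i x, (0 <= h i x)%R.
Hypothesis mh : forall i, D i -> measurable_fun setT (h i).

Let mEh i : D i -> measurable_fun setT (EFin \o h i).
Proof. by move=> Di; exact/measurable_EFinP/mh. Qed.

(** The set function [B |-> sum_i int_B h_i dmu_i]. *)
Definition density_sum (B : set T) : \bar R :=
  \esum_(i in D) \int[mu_ i]_(x in B) (h i x)%:E.

Let density_sum0 : density_sum set0 = 0.
Proof. by rewrite /density_sum esum1// => i _; rewrite integral_set0. Qed.

Let density_sum_ge0 B : 0 <= density_sum B.
Proof. by apply: esum_ge0 => i _; by apply: integral_ge0 => ? _; rewrite lee_fin. Qed.

Let density_sum_sigma_additive : semi_sigma_additive density_sum.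
Proof.
move=> F mF tF mUF.
have -> : density_sum (\bigcup_n F n) = \sum_(n <oo) density_sum (F n).
  rewrite nneseries_esumT// esum_exchange; last first.
    by move=> *; apply: integral_ge0 => ? _; rewrite lee_fin.
  apply: eq_esum => i Di; rewrite ge0_integral_bigcup//.
  - by rewrite nneseries_esumT// => n; apply: integral_ge0 => ? _; rewrite lee_fin.
  - by apply: measurable_funTS; exact: mEh.
  - by move=> x _; rewrite lee_fin.
by apply: is_cvg_nneseries => *; exact: density_sum_ge0.
Qed.

HB.instance Definition _ := isMeasure.Build _ _ _ density_sum
  density_sum0 density_sum_ge0 density_sum_sigma_additive.

Let integral_density_nnsfun (nu : {measure set T -> \bar R}) (f : {nnsfun T >-> R}) :
  (forall B, measurable B -> nu B = density_sum B) ->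
  \int[nu]_x (f x)%:E = \esum_(i in D) \int[mu_ i]_x ((f x)%:E * (h i x)%:E).
Proof.
move=> nuE; rewrite integralT_nnsfun sintegralE.
transitivity (\sum_(y \in range f)
    \esum_(i in D) (y%:E * \int[mu_ i]_(x in f @^-1` [set y]) (h i x)%:E)).
  apply: eq_fsbigr => y; rewrite inE => -[x _ <-].
  rewrite nuE// esumZl// => i _.
  by apply: integral_ge0 => ? _; rewrite lee_fin.
rewrite fsbig_finite//= big_seq -esum_sum; last first.
  move=> i y Di; rewrite in_fset_set// inE => -[x _ <-].
  by rewrite mule_ge0 ?lee_fin//; apply: integral_ge0 => ? _; rewrite lee_fin.
apply: eq_esum => i Di; rewrite -big_seq -fsbig_finite//=.
transitivity (\int[mu_ i]_x
  (\sum_(y \in range f) (y%:E * ((EFin \o h i) \_ (f @^-1` [set y])) x))); last first.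
  apply: eq_integral => x _; rewrite [in RHS]fimfunE -fsumEFin//.
  rewrite ge0_mule_fsuml; last by move=> y; exact: nnfun_muleindic_ge0.
  apply: eq_fsbigr => y _; rewrite EFinM -muleA; congr (_ * _).
  by rewrite epatch_indic muleC.
rewrite ge0_integral_fsum//=.
- apply: eq_fsbigr => y; rewrite inE => -[x _ <-].
  rewrite ge0_integralZl ?lee_fin//; last 2 first.
  + by apply/(measurable_restrictT _ _).1 => //; exact/measurable_funTS/mEh.
  + by move=> z _; apply: erestrict_ge0 => t _; rewrite /= lee_fin.
  by rewrite integral_mkcond.
- move=> y; apply: emeasurable_funM => //.
  by apply/(measurable_restrictT _ _).1 => //; exact/measurable_funTS/mEh.
- move=> y x _; rewrite /patch; case: ifPn => [|_]; last by rewrite mule0.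
  by rewrite inE => /= <-; rewrite mule_ge0// lee_fin.
Qed.

(** Integration against a sum of measures with densities. The statement is about
    any measure [nu] that coincides with [density_sum], so that it also applies
    to restrictions and to measures obtained existentially. *)
Lemma integral_density_sum (nu : {measure set T -> \bar R}) (g : T -> \bar R) :
  (forall B, measurable B -> nu B = density_sum B) ->
  measurable_fun setT g -> (forall x, 0 <= g x) ->
  \int[nu]_x g x = \esum_(i in D) \int[mu_ i]_x (g x * (h i x)%:E).
Proof.
move=> nuE mg g0; pose f n := nnsfun_approx measurableT mg n.
have fg x : (f n x)%:E @[n --> \oo] --> g x by exact: cvg_nnsfun_approx.
have ndf x m n : (m <= n)%N -> (f m x <= f n x)%R.
  by move=> mn; exact/lefP/nd_nnsfun_approx.
have f_le_g n x : (f n x)%:E <= g x.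
  apply: (cvge_ge _ (fg x)); exists n => // m /= nm.
  by rewrite lee_fin ndf.
have cvgnu : \int[nu]_x (f n x)%:E @[n --> \oo] --> \int[nu]_x g x.
  have -> : g = (fun x => limn (fun n => (f n x)%:E)).
    by apply/funext => x; apply/esym/cvg_lim.
  apply: cvg_monotone_convergence => //.
  - by move=> n; exact/measurable_EFinP.
  - by move=> n x _; rewrite lee_fin.
  - by move=> x _ m n mn; rewrite lee_fin ndf.
have mfh i n : D i -> measurable_fun setT (fun x => (f n x)%:E * (h i x)%:E).
  by move=> Di; apply: emeasurable_funM; [exact/measurable_EFinP|exact: mEh].
have cvgi i : D i ->
    \int[mu_ i]_x ((f n x)%:E * (h i x)%:E) @[n --> \oo]
      --> \int[mu_ i]_x (g x * (h i x)%:E).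
  move=> Di.
  have -> : (fun x => g x * (h i x)%:E) =
      (fun x => limn (fun n => (f n x)%:E * (h i x)%:E)).
    by apply/funext => x; apply/esym/cvg_lim => //; exact: cvgeZr.
  apply: cvg_monotone_convergence => //.
  - by move=> n; exact: mfh.
  - by move=> n x _; rewrite mule_ge0 ?lee_fin.
  - by move=> x _ m n mn; rewrite lee_wpmul2r ?lee_fin ?ndf.
apply/eqP; rewrite eq_le; apply/andP; split.
  rewrite -(cvg_lim _ cvgnu)//; apply: lime_le; first by apply/cvg_ex; eexists; exact: cvgnu.
  apply: nearW => n; rewrite integral_density_nnsfun//; apply: le_esum => i Di.
  apply: ge0_le_integral => //.
  - by move=> x _; rewrite mule_ge0 ?lee_fin.
  - exact: mfh.
  - by apply: emeasurable_funM => //; exact: mEh.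
  - by move=> x _; rewrite lee_wpmul2r ?lee_fin ?h0.
apply: ge_ereal_sup => _ [X [finX XD] <-].
rewrite fsbig_finite//=.
have cvgX : \sum_(i <- fset_set X) \int[mu_ i]_x ((f n x)%:E * (h i x)%:E)
    @[n --> \oo] --> \sum_(i <- fset_set X) \int[mu_ i]_x (g x * (h i x)%:E).
  rewrite big_seq.
  under eq_fun do rewrite big_seq.
  apply: cvg_nnesum => i; rewrite in_fset_set// inE => Xi.
    by apply: nearW => n; apply: integral_ge0 => x _; rewrite mule_ge0 ?lee_fin.
  exact/cvgi/XD.
rewrite -(cvg_lim _ cvgX)// -(cvg_lim _ cvgnu)//.
apply: lee_lim.
- by apply/cvg_ex; eexists; exact: cvgX.
- by apply/cvg_ex; eexists; exact: cvgnu.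
apply: nearW => n; rewrite integral_density_nnsfun//; apply: esum_ge.
by exists X => //; rewrite fsbig_finite.
Qed.

Lemma density_sum_finite_measure : density_sum setT < +oo ->
  exists m : {finite_measure set T -> \bar R}, forall B, m B = density_sum B.
Proof.
move=> moo; exists (mfrestr (f := density_sum) measurableT moo) => B.
by rewrite /mfrestr /mrestr; congr (density_sum _); rewrite setIT.
Qed.

End density_sum.

Section bounded_derivative.
Local Open Scope ereal_scope.
Context d (T : measurableType d) (R : realType).

Lemma ge0_integral_mrestr (m : {measure set T -> \bar R}) (C : set T)
    (mC : measurable C) (g : T -> \bar R) :
  measurable_fun setT g -> (forall x, 0 <= g x) ->
  \int[mrestr m mC]_x g x = \int[m]_(x in C) g x.
Proof.
move=> mg g0.
have ttE : [set: unit] = [set tt] by apply/seteqP; split=> // -[].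
rewrite (@integral_density_sum _ _ _ unit setT (fun=> m) (fun=> \1_C)) //.
- rewrite ttE esum_set1; last by apply: integral_ge0 => x _; rewrite mule_ge0 ?lee_fin.
  by rewrite [RHS]integral_mkcond epatch_indic.
- move=> B mB; rewrite /density_sum ttE esum_set1; last first.
    by apply: integral_ge0 => x _; rewrite lee_fin.
  by rewrite integral_indic// setIC.
Qed.

(** If [nu] is absolutely continuous with respect to [mu], then the space is
    exhausted by sets [S k] on which [nu <= k mu], namely the sublevel sets of
    the Radon-Nikodym derivative. *)
Lemma Radon_Nikodym_exhaustion (nu mu : {finite_measure set T -> \bar R}) :
  nu `<< mu ->
  exists S : nat -> set T,
    [/\ forall k, measurable (S k), nondecreasing_seq S, \bigcup_k S k = setT
      & forall k g, measurable_fun setT g -> (forall x, 0 <= g x) ->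
        \int[nu]_(x in S k) g x <= k%:R%:E * \int[mu]_x g x].
Proof.
move=> numu; pose h := Radon_Nikodym_SigmaFinite.f nu mu.
have h0 := Radon_Nikodym_SigmaFinite.f_ge0 numu : forall x, 0 <= h x.
have mh : measurable_fun setT h.
  exact: measurable_int (Radon_Nikodym_SigmaFinite.f_integrable numu).
have mS k : measurable [set x | h x <= k%:R%:E].
  by rewrite -[X in measurable X]setTI; exact: emeasurable_fun_infty_c.
exists (fun k => [set x | h x <= k%:R%:E]); split=> //.
- move=> k l kl; apply/subsetPset => x /= /le_trans; apply.
  by rewrite lee_fin ler_nat.
- apply/seteqP; split=> // x _.
  have hfin : h x \is a fin_num := Radon_Nikodym_SigmaFinite.f_fin_num numu x.
  exists (Num.truncn (fine (h x))).+1 => //=; rewrite -(fineK hfin) lee_fin ltW//.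
  by apply: truncnS_gt.
move=> k g mg g0.
rewrite -(Radon_Nikodym_SigmaFinite.change_of_variables numu)//; last exact: measurable_funTS.
rewrite -ge0_integralZl//.
apply: (@le_trans _ _ (\int[mu]_(x in [set x | h x <= k%:R%:E]) (k%:R%:E * g x))).
  apply: ge0_le_integral => //.
  - by move=> x _; rewrite mule_ge0 ?h0.
  - by apply: measurable_funTS; exact: emeasurable_funM.
  - by apply: measurable_funTS; exact: measurable_funeM.
  - by move=> x /= hk; rewrite muleC lee_wpmul2r.
apply: ge0_subset_integral => //; first exact: measurable_funeM.
by move=> x _; rewrite mule_ge0// lee_fin.
Qed.

End bounded_derivative.

(** * Trigonometric polynomials and arc length *)

Section arc_length.
Context (R : realType).

Let trig (k a b : R) (t : R) : R := a * cos (k * t) + b * sin (k * t).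

(** A primitive of [trig k a b]. *)
Let trig_prim (k a b : R) (t : R) : R :=
  if k == 0 then a * t else k^-1 * (a * sin (k * t) - b * cos (k * t)).

Let is_derive_trig_prim (k a b t : R) :
  is_derive t 1 (trig_prim k a b) (trig k a b t).
Proof.
rewrite /trig_prim /trig; have [->|k0] := eqVneq k 0.
  rewrite !mul0r cos0 sin0 mulr0 addr0.
  by have := is_deriveZ a (is_derive_id t 1).
have dk : is_derive t 1 (fun t => k * t) k.
  by have := is_deriveZ k (is_derive_id t 1); rewrite /GRing.scale/= mulr1.
have ds := is_derive1_comp (is_derive_sin (k * t)) dk.
have dc := is_derive1_comp (is_derive_cos (k * t)) dk.
have := is_deriveZ k^-1 (is_deriveB (is_deriveZ a ds) (is_deriveZ b dc)).
move=> H; apply: is_derive_eq; rewrite /GRing.scale/=.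
by field.
Qed.

Let derivable_trig (k a b t : R) : derivable (trig k a b) t 1.
Proof.
have dk : is_derive t 1 (fun t => k * t) k.
  by have := is_deriveZ k (is_derive_id t 1); rewrite /GRing.scale/= mulr1.
have ds := is_derive1_comp (is_derive_sin (k * t)) dk.
have dc := is_derive1_comp (is_derive_cos (k * t)) dk.
by have [] := is_deriveD (is_deriveZ a dc) (is_deriveZ b ds).
Qed.

Let trig_prim_period (k a b : R) : cos (k * (2 * pi)) = 1 -> sin (k * (2 * pi)) = 0 ->
  trig_prim k a b (2 * pi) - trig_prim k a b 0 = if k == 0 then a * (2 * pi) else 0.
Proof.
rewrite /trig_prim => c1 s0; case: ifP => _; first by rewrite mulr0 subr0.
by rewrite c1 s0 !mulr0 sin0 cos0 !mulr0 subrr.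
Qed.

Lemma circle_paramX (t : R) n :
  (circle_param t : R[i]) ^+ n = (cos (n%:R * t) +i* sin (n%:R * t))%C.
Proof.
elim: n => [|n IH]; first by rewrite expr0 mul0r cos0 sin0.
rewrite exprS IH /circle_param/= -natr1 mulrDl mul1r [n%:R * t + t]addrC.
by rewrite cosD sinD; congr (_ +i* _)%C; rewrite addrC.
Qed.

Let circle_period n : cos (n%:R * (2 * pi)) = 1 :> R /\ sin (n%:R * (2 * pi)) = 0 :> R.
Proof.
have c1 : (circle_param (2 * pi) : R[i]) = 1.
  by rewrite /circle_param mulr_natl cos2pi sin2pi.
by have := circle_paramX (2 * pi) n; rewrite c1 expr1n => -[<- <-].
Qed.

Lemma measurable_circle_param : measurable_fun setT (@circle_param R).
Proof.
apply: measurable_complexP => /=; apply: continuous_measurable_fun.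
  exact: continuous_cos.
exact: continuous_sin.
Qed.

(** The real form of the squared modulus of [sum_n a_n e^(int)], a sum of
    harmonics of integral frequencies [m - n]. *)
Definition trig_poly (N : nat) (a : nat -> R[i]) (t : R) : R :=
  \sum_(m < N) \sum_(n < N)
   trig (m%:R - n%:R)
     (complex.Re (a m) * complex.Re (a n) + complex.Im (a m) * complex.Im (a n))
     (complex.Re (a m) * complex.Im (a n) - complex.Im (a m) * complex.Re (a n)) t.

Lemma sqr_rnorm_trig_poly N (a : nat -> R[i]) (t : R) :
  rnorm (\sum_(n < N) a n * (circle_param t : R[i]) ^+ n) ^+ 2 = trig_poly N a t.
Proof.
rewrite sqr_rnorm_complex !raddf_sum/= !expr2 !big_distrlr -big_split/=.
apply: eq_bigr => m _; rewrite -big_split; apply: eq_bigr => n _ /=.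
rewrite !circle_paramX; case: (a m) => xm ym; case: (a n) => xn yn /=.
rewrite /trig !mulrBl sinB cosB; ring.
Qed.

(** Orthogonality of the exponentials. The whole double sum is integrated by the
    fundamental theorem of calculus: only the primitives of its diagonal terms
    are not periodic. *)
Lemma integral_trig_poly N (a : nat -> R[i]) :
  (\int[@lebesgue_measure R]_(t in `[0%R, (2 * pi)%R]) (trig_poly N a t)%:E
   = (2 * pi * \sum_(n < N) rnorm (a n) ^+ 2)%:E)%E.
Proof.
pose F : R -> R := \sum_(m < N) \sum_(n < N)
   trig_prim (m%:R - n%:R)
     (complex.Re (a m) * complex.Re (a n) + complex.Im (a m) * complex.Im (a n))
     (complex.Re (a m) * complex.Im (a n) - complex.Im (a m) * complex.Re (a n)).
have dF (t : R) : is_derive t (1 : R) F (trig_poly N a t).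
  by apply: is_derive_sum => m; apply: is_derive_sum => n.
have dF1 (t : R) : derivable F t (1 : R) by apply: ex_derive; exact: dF.
have cF : continuous F.
  by move=> t; apply/differentiable_continuous/derivable1_diffP.
rewrite (@continuous_FTC2 _ _ F).
- rewrite -EFinB; congr (_%:E); rewrite /F !fct_sumE -sumrB mulr_sumr.
  apply: eq_bigr => m _; rewrite !fct_sumE -sumrB (bigD1 m)//= big1 => [|n nm].
    rewrite addr0 trig_prim_period ?subrr ?mul0r ?cos0 ?sin0// eqxx.
    by rewrite sqr_rnorm_complex; ring.
  have [cm sm] := circle_period m; have [cn sn] := circle_period n.
  rewrite trig_prim_period ?mulrBl ?cosB ?sinB ?cm ?sm ?cn ?sn//; last 2 first.
  + by rewrite mulr1 mulr0 addr0.
  + by rewrite mulr0 mul0r subr0.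
  by rewrite subr_eq0 eqr_nat eq_sym -(inj_eq val_inj) in nm *; rewrite (negPf nm).
- by rewrite mulr_gt0// pi_gt0.
- apply: continuous_subspaceT => t.
  apply/differentiable_continuous/derivable1_diffP.
  rewrite (_ : trig_poly N a = \sum_(m < N) \sum_(n < N)
   trig (m%:R - n%:R)
     (complex.Re (a m) * complex.Re (a n) + complex.Im (a m) * complex.Im (a n))
     (complex.Re (a m) * complex.Im (a n) - complex.Im (a m) * complex.Re (a n))).
    by apply: derivable_sum => m; apply: derivable_sum => n.
  by apply/funext => u; rewrite fct_sumE; apply: eq_bigr => m _; rewrite fct_sumE.
- split=> //.
  + exact: cvg_at_right_filter (cF 0).
  + exact: cvg_at_left_filter (cF (2 * pi)).
- by move=> t _; rewrite derive1E; have := dF t => -[].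
Qed.

(** Arc length is a finite measure for which the monomials are orthogonal. *)
Lemma arc_length_finite_measure :
  exists2 m : {finite_measure set (borelC R) -> \bar R},
    (forall B, m B = arc_length R B) &
    forall N (a : nat -> R[i]),
      (\int[m]_z (rnorm (\sum_(n < N) a n * (z : R[i]) ^+ n) ^+ 2)%:E =
       (2 * pi * \sum_(n < N) rnorm (a n) ^+ 2)%:E)%E.
Proof.
pose leb := mrestr (@lebesgue_measure R) (measurable_itv `[(0 : R), 2 * pi[).
pose arc0 := pushforward leb (@circle_param R) : {measure set (borelC R) -> \bar R}.
pose arc := arc0 measurable_circle_param.
have arcoo : (arc setT < +oo)%E.
  rewrite [ltLHS](_ : _ = lebesgue_measure `[(0 : R), 2 * pi[).
    by rewrite lebesgue_measure_itv/= lte_fin mulr_gt0 ?pi_gt0// -EFinB ltry.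
  by rewrite /arc /arc0 /= /pushforward /leb /mrestr preimage_setT setTI.
exists (mfrestr measurableT arcoo) => [B|N a].
  by transitivity (arc (B `&` setT)); last rewrite setIT.
pose g (z : borelC R) := (rnorm (\sum_(n < N) a n * (z : R[i]) ^+ n) ^+ 2).
have mg : measurable_fun setT g.
  exact: measurable_rnorm2 (measurable_complex_poly N a).
rewrite /mfrestr ge0_integral_mrestr; last 2 first.
- exact/measurable_EFinP.
- by move=> z; rewrite lee_fin sqr_ge0.
rewrite ge0_integral_pushforward//; last 3 first.
- exact: measurable_circle_param.
- exact/measurable_EFinP.
- by move=> z _; rewrite lee_fin sqr_ge0.
rewrite preimage_setT ge0_integral_mrestr; last 2 first.
- apply/measurable_EFinP; exact: measurableT_comp mg measurable_circle_param.
- by move=> z; rewrite lee_fin sqr_ge0.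
rewrite integral_itv_bndo_bndc; last first.
  apply/measurable_funTS/measurable_EFinP.
  exact: measurableT_comp mg measurable_circle_param.
rewrite -integral_trig_poly; apply: eq_integral => t _.
by rewrite /= sqr_rnorm_trig_poly.
Qed.
End arc_length.

(** * Borel functions of the operator in the multiplication model *)

Section multiplication_model.
Context (R : realType) (H : completeNormedModType R[i]).
Variable dot : {dot H for Num.conj}.
Hypothesis H_norm : hilbert_norm dot.
Variables (A : {linear H -> H})
  (mu_ : option nat -> {finite_measure set (borelC R) -> \bar R})
  (U : H -> option nat * nat -> borelC R -> borelC R).
Hypothesis U_unitary : unitary_to_model mu_ U.
Hypothesis U_A : forall f, model_eq mu_ (U (A f)) (mul_by_z (U f)).

Lemma measurable_model f p : copy_index p -> measurable_fun setT (U f p).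
Proof. by have [/(_ f)[mU _] _ _ _] := U_unitary; exact: mU. Qed.

Lemma model_eq_lin (a : R[i]) x y Phi Psi :
  model_eq mu_ (U x) Phi -> model_eq mu_ (U y) Psi ->
  model_eq mu_ (U (a *: x + y))
    (fun p z => a * (Phi p z : R[i]) + (Psi p z : R[i])).
Proof.
move=> xPhi yPsi p cp; have [_ /(_ a x y p cp) Ulin _ _] := U_unitary.
have := xPhi p cp; have := yPsi p cp; apply: filterS3 Ulin.
by move=> z -> -> ->.
Qed.

(** The norm of [x] computed on any representative of its image in the model. *)
Lemma model_norm x Phi : (forall p, copy_index p -> measurable_fun setT (Phi p)) ->
  model_eq mu_ (U x) Phi ->
  (\esum_(p in copy_index) \int[mu_ p.1]_z ((rnorm (Phi p z : R[i]) ^+ 2)%:E))%E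
  = (rnorm x ^+ 2)%:E.
Proof.
move=> mPhi xPhi; have [_ _ /(_ x) <- _] := U_unitary.
apply: eq_esum => p cp; apply: ge0_ae_eq_integral => //.
- by apply: measurable_rnorm2E; exact: mPhi.
- by apply: measurable_rnorm2E; exact: measurable_model.
- by move=> z _; rewrite lee_fin sqr_ge0.
- by move=> z _; rewrite lee_fin sqr_ge0.
by have := xPhi p cp; apply: filterS => z -> _.
Qed.

(** [multiple psi f x] means that [x] is [psi(A) f] in the Borel functional
    calculus of [A]: in the model, [x] is [f] multiplied by [psi]. It is a
    relation because [psi(A) f] exists only if [psi] is suitably bounded. *)
Definition multiple (psi : borelC R -> R[i]) (f x : H) : Prop :=
  model_eq mu_ (U x) (fun p z => psi z * (U f p z : R[i])).

Lemma multiple1 f : multiple (fun=> 1) f f.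
Proof. by move=> p _; apply: aeW => z; rewrite mul1r. Qed.

Lemma multiple0 f : multiple (fun=> 0) f 0.
Proof.
move=> p cp; have [_ /(_ (-1) f f p cp) + _ _] := U_unitary.
by rewrite scaleN1r addNr; apply: filterS => z ->; rewrite mul0r mulN1r addNr.
Qed.

Lemma multiple_lin a psi phi f x y : multiple psi f x -> multiple phi f y ->
  multiple (fun z => a * psi z + phi z) f (a *: x + y).
Proof.
move=> fx fy p cp; have := model_eq_lin a fx fy cp; apply: filterS => z ->.
by rewrite mulrDl mulrA.
Qed.

Lemma multiple_linr a psi f g x y : multiple psi f x -> multiple psi g y ->
  multiple psi (a *: f + g) (a *: x + y).
Proof.
move=> fx gy p cp; have [_ /(_ a f g p cp) + _ _] := U_unitary.
have := model_eq_lin a fx gy cp; apply: filterS2 => z -> ->.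
by rewrite mulrDr mulrCA.
Qed.

Lemma multiple_A psi f x : multiple psi f x ->
  multiple (fun z => (z : R[i]) * psi z) f (A x).
Proof.
move=> fx p cp; have := U_A x cp; have := fx p cp; apply: filterS2 => z Ux ->.
by rewrite /mul_by_z Ux mulrA.
Qed.

Lemma multiple_iterA psi f x n : multiple psi f x ->
  multiple (fun z => (z : R[i]) ^+ n * psi z) f (iter n A x).
Proof.
move=> fx; elim: n => [|n IH] /=.
  by move=> p cp; have := fx p cp; apply: filterS => z ->; rewrite mul1r.
move=> p cp; have := multiple_A IH cp; apply: filterS => z ->.
by rewrite exprS !mulrA.
Qed.

Lemma multiple_polyA psi f x N (a : nat -> R[i]) : multiple psi f x ->
  multiple (fun z => (\sum_(n < N) a n * (z : R[i]) ^+ n) * psi z) f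
    (\sum_(n < N) a n *: iter n A x).
Proof.
move=> fx; elim: N => [|N IH] p cp.
  have := multiple0 f cp; rewrite big_ord0.
  by apply: filterS => z ->; rewrite big_ord0 !mul0r.
rewrite big_ord_recr/= addrC.
have := multiple_lin (a N) (multiple_iterA N fx) IH cp.
apply: filterS => z ->; rewrite big_ord_recr/= addrC; congr (_ * _).
by rewrite mulrDl mulrA.
Qed.

Lemma measurable_multiple psi f p :
  measurable_fun setT (psi : borelC R -> borelC R) -> copy_index p ->
  measurable_fun setT (fun z => psi z * (U f p z : R[i]) : borelC R).
Proof.
move=> mpsi cp; apply: (measurable_complexM (f := psi)) => //.
exact: measurable_model.
Qed.

(** [psi(A) f] exists when [psi] is Borel and bounded by 1. *)
Lemma multiple_ex psi f : measurable_fun setT (psi : borelC R -> borelC R) ->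
  (forall z, rnorm (psi z) <= 1) -> exists x, multiple psi f x.
Proof.
move=> mpsi psi1; have [/(_ f)[_ foo] _ _] := U_unitary; apply; split.
  by move=> p; exact: measurable_multiple.
apply: le_lt_trans foo; apply: le_esum => p cp; apply: ge0_le_integral => //.
- by move=> z _; rewrite lee_fin sqr_ge0.
- by apply: measurable_rnorm2E; exact: measurable_multiple.
- by apply: measurable_rnorm2E; exact: measurable_model.
move=> z _; rewrite lee_fin rnormM exprMn ler_piMl ?sqr_ge0//.
by rewrite exprn_ile1// rnorm_ge0.
Qed.

(** The spectral measure of [f]: it integrates [|psi|^2] to the squared norm of
    [psi(A) f], and it does not charge the common null sets of the [mu_j]. All
    later estimates take place on this single finite measure. *)
Lemma spectral_measure_ex f :
  exists2 m : {finite_measure set (borelC R) -> \bar R},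
    (forall B, measurable B -> (forall j, mu_ j B = 0%E) -> m B = 0%E) &
    forall psi x, measurable_fun setT (psi : borelC R -> borelC R) ->
      multiple psi f x ->
      (\int[m]_z (rnorm (psi z) ^+ 2)%:E = (rnorm x ^+ 2)%:E)%E.
Proof.
pose h p z := rnorm (U f p z : R[i]) ^+ 2.
have h0 p z : 0 <= h p z by exact: sqr_ge0.
have mh p : copy_index p -> measurable_fun setT (h p).
  by move=> cp; apply: measurable_rnorm2; exact: measurable_model.
have [|m mE] := @density_sum_finite_measure _ _ R _ copy_index (fun p => mu_ p.1) h h0 mh.
  by have [/(_ f)[_ +] _ _ _] := U_unitary.
exists m => [B mB B0|psi x mpsi fx].
  rewrite mE /density_sum esum1// => p cp; rewrite null_set_integral//; last exact: B0.
  by apply: measurable_funTS; apply/measurable_EFinP; exact: mh.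
rewrite (integral_density_sum h0 mh (fun B _ => mE B)); last 2 first.
- exact: (measurable_rnorm2E (f := psi)).
- by move=> z; rewrite lee_fin sqr_ge0.
rewrite -(model_norm _ fx); last by move=> p; exact: measurable_multiple.
apply: eq_esum => p cp; apply: eq_integral => z _.
by rewrite rnormM exprMn EFinM.
Qed.

(** Real functions of [A] are self-adjoint, at the level of real parts. By
    polarization it is enough to compare norms of sums and differences, where
    the identity [|F + w G|^2 + |w F - G|^2 = |F - w G|^2 + |w F + G|^2] holds
    pointwise and involves nonnegative terms only. *)
Lemma real_multiple_selfadjoint_re (w : borelC R -> R) f g x y :
  measurable_fun setT w ->
  multiple (fun z => (w z)%:C%C) f x -> multiple (fun z => (w z)%:C%C) g y ->
  redot dot f y = redot dot x g.
Proof.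
move=> mw fx gy.
have mW : measurable_fun setT (fun z => (w z)%:C%C : borelC R).
  exact: measurable_real_complex.
have meq_refl u : model_eq mu_ (U u) (U u) by move=> p _; exact: aeW.
have mlin (a : R[i]) (Phi Psi : borelC R -> borelC R) :
    measurable_fun setT Phi -> measurable_fun setT Psi ->
    measurable_fun setT (fun z => a * (Phi z : R[i]) + (Psi z : R[i]) : borelC R).
  move=> mPhi mPsi; apply: measurable_complexD => //.
  by apply: (measurable_complexM (f := fun=> a)) => //; exact: measurable_cst.
have N1 := model_norm _ (model_eq_lin 1 gy (meq_refl f)).
have N2 := model_norm _ (model_eq_lin (-1) (meq_refl g) fx).
have N3 := model_norm _ (model_eq_lin (-1) gy (meq_refl f)).
have N4 := model_norm _ (model_eq_lin 1 (meq_refl g) fx).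
have : ((rnorm (1 *: y + f) ^+ 2)%:E + (rnorm (-1 *: g + x) ^+ 2)%:E =
        (rnorm (-1 *: y + f) ^+ 2)%:E + (rnorm (1 *: g + x) ^+ 2)%:E)%E.
  have mfg p : copy_index p ->
      measurable_fun setT (fun z => (w z)%:C%C * (U g p z : R[i]) : borelC R).
    by move=> cp; exact: measurable_multiple.
  have mfx p : copy_index p ->
      measurable_fun setT (fun z => (w z)%:C%C * (U f p z : R[i]) : borelC R).
    by move=> cp; exact: measurable_multiple.
  rewrite -N1 -?N2 -?N3 -?N4; [|
    by move=> p cp; apply: mlin; solve [exact: mfg|exact: mfx|exact: measurable_model]..].
  rewrite -!esumD; [|by move=> p _; apply: integral_ge0 => z _; rewrite lee_fin sqr_ge0..].
  apply: eq_esum => p cp; rewrite -!ge0_integralD//;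
    do ?[by move=> z _; rewrite lee_fin sqr_ge0|
         by apply: measurable_rnorm2E; apply: mlin;
           solve [exact: mfg|exact: mfx|exact: measurable_model]].
  apply: eq_integral => z _; rewrite -!EFinD !sqr_rnorm_complex.
  case: (U f p z : R[i]) => a b; case: (U g p z : R[i]) => a' b' /=.
  by congr (_%:E); ring.
rewrite -!EFinD => -[]; rewrite !scale1r !scaleN1r addrC [y + f]addrC.
rewrite [- g + x]addrC [- y + f]addrC [g + x]addrC.
rewrite !(sqr_rnormB H_norm) !(sqr_rnormD H_norm).
lra.
Qed.

End multiplication_model.

(** * Complete Bessel systems of orbits *)

Section orbits.
Context (R : realType) (H : completeNormedModType R[i]).
Variable dot : {dot H for Num.conj}.
Hypothesis H_norm : hilbert_norm dot.
Variable A : {linear H -> H}.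

(** The coefficients of an orbit system, summed along each orbit first. *)
Lemma coef_sum_orbit (G : set H) f :
  (Defs.coef_sum dot (orbit_index G) (orbit_family A) f =
   \esum_(g in G) \esum_(n in [set: nat])
     (rnorm (dot f (iter n A g)) ^+ 2)%:E)%E.
Proof.
rewrite esum_esum; last by move=> *; rewrite lee_fin sqr_ge0.
by [].
Qed.

(** The orbit of [g] satisfies the synthesis bound dual to Bessel's inequality.
    Stated this way, the condition involves norms only and can be read on the
    spectral measure of [g]. *)
Definition bessel_vector (beta : R) (g : H) : Prop :=
  forall N (a : nat -> R[i]),
    rnorm (\sum_(n < N) a n *: iter n A g) ^+ 2 <=
    beta * \sum_(n < N) rnorm (a n) ^+ 2.

(** The synthesis bound implies the Bessel bound along the orbit. *)
Lemma bessel_vectorP beta g f : 0 < beta -> bessel_vector beta g ->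
  (\esum_(n in [set: nat]) (rnorm (dot f (iter n A g)) ^+ 2)%:E
   <= (beta * rnorm f ^+ 2)%:E)%E.
Proof.
move=> beta0 gB; rewrite -nneseries_esumT; last by move=> n; rewrite lee_fin sqr_ge0.
apply: lime_le; first by apply: is_cvg_nneseries => *; rewrite lee_fin sqr_ge0.
apply: nearW => N; rewrite sumEFin big_mkord lee_fin.
set S := (X in X <= _).
pose a n := dot f (iter n A g).
have := gB N a; rewrite -/S; set x := (X in rnorm X) => xS.
have fx : redot dot f x = S.
  rewrite /redot dot_sumr raddf_sum; apply: eq_bigr => n _ /=.
  by rewrite dotZr mulrC -/(a n) -normCK -rnorm_eq -rmorphXn.
(* Expand 0 <= |beta f - x|^2, where Re <f, x> = S and |x|^2 <= beta S. *)
have := sqr_ge0 (rnorm (beta%:C%C *: f - x)).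
rewrite (sqr_rnormB H_norm) /redot dotZl.
have -> : complex.Re (beta%:C%C * dot f x) = beta * S.
  by rewrite -fx /redot; case: (dot f x) => u v /=; rewrite mul0r subr0.
rewrite rnormZ exprMn rnorm_real gtr0_norm//.
move=> h; rewrite -(ler_pM2l beta0) mulrA -expr2; lra.
Qed.

Lemma bessel_vectorZ beta g (c : R) : bessel_vector beta g ->
  bessel_vector (c ^+ 2 * beta) (c%:C%C *: g).
Proof.
move=> gB N a.
have -> : \sum_(n < N) a n *: iter n A (c%:C%C *: g) =
    c%:C%C *: \sum_(n < N) a n *: iter n A g.
  rewrite scaler_sumr; apply: eq_bigr => n _.
  have -> : iter n A (c%:C%C *: g) = c%:C%C *: iter n A g.
    by elim: (n : nat) => //= k ->; rewrite linearZ.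
  by rewrite !scalerA mulrC.
rewrite rnormZ exprMn rnorm_real real_normK ?num_real// -mulrA.
by rewrite ler_wpM2l ?sqr_ge0.
Qed.

(** If the vectors with a Bessel orbit are dense, then a countable set of them
    can be rescaled into the generators of a complete Bessel system: positive
    scalars do not change the span, and they can make the Bessel bounds of the
    orbits summable. *)
Lemma complete_bessel_orbits : separable_space H ->
  (forall f (eps : R), 0 < eps -> exists2 g, rnorm (f - g) < eps &
     exists2 beta : R, 0 < beta & bessel_vector beta g) ->
  exists G : set H,
    [/\ countable G,
        complete_family (orbit_index G) (orbit_family A)
      & bessel dot (orbit_index G) (orbit_family A)].
Proof.
move=> /separable_sequence[d ddense] Bdense.
(* The code m of the pair (n, k) gives a Bessel vector at distance less than
   1/(k+1) from the n-th term of the dense sequence. *)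
have /choice[v vP] : forall m : nat, exists gb : H * R,
    [/\ 0 < gb.2, bessel_vector gb.2 gb.1 &
      forall n k : nat, choice.unpickle m = Some (n, k) ->
        rnorm (d n - gb.1) < k.+1%:R^-1].
  move=> m; case E : (choice.unpickle m : option (nat * nat)) => [[n k]|]; last first.
    by have [g _ [b b0 gb]] := Bdense 0 1 ltr01; exists (g, b).
  have [|g dg [b b0 gb]] := Bdense (d n) k.+1%:R^-1; first by rewrite invr_gt0.
  by exists (g, b); split=> // _ _ [<- <-].
(* With this factor the rescaled orbit has Bessel bound 2^-(m+1). *)
pose c m : R := Num.sqrt (2 ^- m.+1 / (v m).2).
have c0 m : 0 < c m.
  by rewrite sqrtr_gt0 divr_gt0//; have [] := vP m.
have c2 m : c m ^+ 2 * (v m).2 = 2 ^- m.+1.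
  have [v0 _ _] := vP m; rewrite sqr_sqrtr ?divfK ?gt_eqF//.
  by rewrite divr_ge0 ?ltW// invr_gt0 exprn_gt0.
pose w m : H := (c m)%:C%C *: (v m).1.
have wB m : bessel_vector (2 ^- m.+1) (w m).
  by rewrite -c2; apply: bessel_vectorZ; have [] := vP m.
exists (range w); split.
- exact: card_image_le.
- apply/seteqP; split=> // f _ V /nbhs_ballP[e /= e0 eV].
  have eR : e = (complex.Re e)%:C%C by rewrite RRe_real// gtr0_real.
  set e' := complex.Re e in eR.
  have e'0 : 0 < e' by rewrite -ltcR -eR.
  have [|n fn] := ddense f (e' / 2); first by rewrite divr_gt0.
  have [k ke] : exists k, k.+1%:R^-1 < e' / 2.
    have e'20 : 0 < e' / 2 by rewrite divr_gt0.
    have [k _ /(_ k (leqnn k)) ?] := near_infty_natSinv_lt (PosNum e'20).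
    by exists k.
  pose m := choice.pickle (n, k).
  have [_ _ /(_ n k (choice.pickleK _)) dv] := vP m.
  exists (v m).1; split; last first.
    apply: eV; rewrite -ball_normE/= -rnorm_eq eR ltcR.
    have -> : f - (v m).1 = (f - d n) + (d n - (v m).1) by rewrite addrA subrK.
    by apply: le_lt_trans (ler_rnormD _ _) _; rewrite (splitr e') ltrD// (lt_trans dv).
  exists 1%N, (fun=> ((c m)^-1)%:C%C), (fun=> w m); split.
    by move=> _; exists (w m, 0%N) => //; split=> //; exists m.
  by rewrite big_ord1 /w scalerA -rmorphM/= mulVf ?gt_eqF// scale1r.
- exists 1 => // f; rewrite coef_sum_orbit mul1r.
  (* Distinct indices may give the same generator: choose one index for each. *)
  have /choice[i iP] : forall g, exists m, range w g -> w m = g.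
    move=> g; have [[m _ <-]|ng] := pselect (range w g); first by exists m.
    by exists 0%N.
  have inj_i : set_inj (range w) i.
    move=> g h /set_mem rg /set_mem rh e; by rewrite -(iP _ rg) -(iP _ rh) e.
  apply: (@le_trans _ _ (\esum_(g in range w) (2 ^- (i g).+1 * rnorm f ^+ 2)%:E)%E).
    apply: le_esum => g /iP gi; rewrite -{1}gi.
    by apply: bessel_vectorP => //; rewrite invr_gt0 exprn_gt0.
  rewrite -(esum_image _ _ (fun m => (2 ^- m.+1 * rnorm f ^+ 2)%:E) inj_i).
  apply: le_trans (subset_esum _ (@subsetT _ _)) _.
  rewrite -nneseries_esumT; last first.
    by move=> m; rewrite lee_fin mulr_ge0 ?sqr_ge0// invr_ge0 exprn_ge0.
  apply: lime_le.
    by apply: is_cvg_nneseries => m _ _; rewrite lee_fin mulr_ge0 ?sqr_ge0//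
      invr_ge0 exprn_ge0.
  apply: nearW => N; rewrite sumEFin big_mkord lee_fin -mulr_suml.
  rewrite ler_piMl ?sqr_ge0//.
  have -> : \sum_(m < N) 2 ^- m.+1 = 1 - 2 ^- N :> R.
    elim: N => [|N IH]; first by rewrite big_ord0 expr0 invr1 subrr.
    rewrite big_ord_recr/= IH exprS invfM; lra.
  by rewrite gerBl invr_ge0 exprn_ge0.
Qed.

End orbits.

(** * Parseval frames of orbits *)

(** A self-adjoint injective [D] with [|D f|^2 = |f|^2 - |A f|^2] turns an
    orthonormal basis into the generators of a Parseval frame, provided that
    the powers of [A] tend strongly to 0. *)
Section parseval_orbits.
Context (R : realType) (H : completeNormedModType R[i]).
Variable dot : {dot H for Num.conj}.
Hypothesis H_norm : hilbert_norm dot.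
Variables (A : {linear H -> H}) (B : H -> H).
Hypothesis AB : is_adjoint dot A B.
Hypothesis normalA : forall f, A (B f) = B (A f).

Lemma adjoint_sym f g : dot (B f) g = dot f (A g).
Proof. by rewrite (dotC dot) -AB -(dotC dot). Qed.

Lemma adjoint_iter f g n : dot f (iter n A g) = dot (iter n B f) g.
Proof. by elim: n f => // n IH f; rewrite /= -adjoint_sym IH -iterSr. Qed.

Lemma rnorm_adjoint f : rnorm (B f) = rnorm (A f).
Proof.
apply/eqP; rewrite -(eqrXn2 (ltn0Sn 1)) ?rnorm_ge0//.
rewrite !(sqr_rnormE H_norm) /redot adjoint_sym normalA -AB.
by rewrite eqxx.
Qed.

Lemma rnorm_iter_adjoint f n : rnorm (iter n B f) = rnorm (iter n A f).
Proof.
elim: n f => // n IH f; rewrite iterS rnorm_adjoint.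
have -> : A (iter n B f) = iter n B (A f) by elim: (n) => //= k <-.
by rewrite IH -iterSr.
Qed.

Variable D : H -> H.
Hypothesis D_sa : forall f g, dot f (D g) = dot (D f) g.
Hypothesis D_norm : forall f, rnorm (D f) ^+ 2 = rnorm f ^+ 2 - rnorm (A f) ^+ 2.
Hypothesis D_inj : injective D.
Hypothesis A_stable : forall f, rnorm (iter n A f) ^+ 2 @[n --> \oo] --> (0 : R).

(** The squared norms of [D B^n f] telescope, because [|B^n f| = |A^n f|] for a
    normal operator. *)
Lemma defect_sum f :
  (\esum_(n in [set: nat]) (rnorm (D (iter n B f)) ^+ 2)%:E = (rnorm f ^+ 2)%:E)%E.
Proof.
rewrite -nneseries_esumT; last by move=> n; rewrite lee_fin sqr_ge0.
apply/cvg_lim => //.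
have -> : (fun N => (\sum_(0 <= n < N) (rnorm (D (iter n B f)) ^+ 2)%:E)%E) =
    (fun N => (rnorm f ^+ 2 - rnorm (iter N A f) ^+ 2)%:E).
  apply/funext => N; rewrite sumEFin; congr (_%:E); elim: N => [|N IH].
    by rewrite big_geq// subrr.
  rewrite big_nat_recr//= IH D_norm -rnorm_adjoint rnorm_iter_adjoint.
  by rewrite (rnorm_iter_adjoint f N.+1) addrA subrK.
apply: cvg_EFin; first exact: nearW.
rewrite -[X in _ --> X]subr0; apply: cvgB (A_stable f); exact: cvg_cst.
Qed.

Lemma parseval_orbits : separable_space H ->
  exists G : set H,
    countable G /\ parseval_frame dot (orbit_index G) (orbit_family A).
Proof.
move=> /(orthonormal_basis H_norm)[e [orth unit parseval]].
(* The zero entries of the basis are left out, so that the generators [D e_n]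
   are pairwise distinct. *)
pose J := [set n | e n <> 0].
have De_inj : set_inj J (D \o e).
  move=> m n /set_mem Jm /set_mem Jn /D_inj emn; apply/eqP.
  apply: contra_notT Jm => mn.
  have := orth _ _ mn; rewrite emn (dot_self H_norm) -emn => -[/eqP].
  by rewrite sqrf_eq0 => /eqP/rnorm_eq0.
exists ((D \o e) @` J); split.
  by apply: (sub_countable (card_image_le _ _)); exact: countableP.
exists 1, 1; split=> //; split=> // f.
suff -> : Defs.coef_sum dot (orbit_index ((D \o e) @` J)) (orbit_family A) f =
    (rnorm f ^+ 2)%:E by rewrite mul1r lexx.
rewrite coef_sum_orbit (esum_image J (D \o e)) //.
rewrite esum_exchange; last by move=> *; rewrite lee_fin sqr_ge0.
rewrite -defect_sum; apply: eq_esum => n _.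
rewrite -parseval nneseries_esumT; last by move=> k; rewrite lee_fin sqr_ge0.
rewrite esum_mkcond; apply: eq_esum => k _.
case: ifPn => [_|]; first by rewrite /= adjoint_iter D_sa.
by move=> /negP; rewrite inE /J/= => /contrapT ->; rewrite linear0 rnorm0 expr0n.
Qed.

End parseval_orbits.

(** * Bessel vectors and the defect operator of a contraction *)

Section disks.
Context (R : realType).

(** Strictly inside the unit disk, a polynomial is controlled by the square sum
    of its coefficients, by comparison with a geometric series. *)
Lemma sqr_rnorm_poly_le (N : nat) (a : nat -> R[i]) (z : R[i]) (c : R) :
  0 < c -> rnorm z <= 1 - c ->
  rnorm (\sum_(n < N) a n * z ^+ n) ^+ 2 <=
  c ^- 2 * \sum_(n < N) rnorm (a n) ^+ 2.
Proof.
move=> c0 zc; set r := rnorm z; set S := \sum_(n < N) rnorm (a n) ^+ 2.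
have r0 : 0 <= r by exact: rnorm_ge0.
have S0 : 0 <= S by apply: sumr_ge0 => n _; exact: sqr_ge0.
have geo : \sum_(n < N) r ^+ n <= c^-1.
  rewrite -(ler_pM2l c0) mulfV ?gt_eqF//.
  apply: (@le_trans _ _ ((1 - r) * \sum_(n < N) r ^+ n)).
    by rewrite ler_wpM2r ?sumr_ge0// => [n _|]; [rewrite exprn_ge0|rewrite -/r in zc; lra].
  have -> : (1 - r) * \sum_(n < N) r ^+ n = 1 - r ^+ N.
    by rewrite -[1 - r ^+ N]opprB subrX1 -mulNr opprB.
  by rewrite gerBl exprn_ge0.
have aS n : (n < N)%N -> rnorm (a n) <= Num.sqrt S.
  move=> nN; rewrite -(@ler_pXn2r _ 2) ?nnegrE ?rnorm_ge0 ?sqrtr_ge0// sqr_sqrtr//.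
  by rewrite /S (bigD1 (Ordinal nN))//= lerDl sumr_ge0// => i _; exact: sqr_ge0.
have le1 : rnorm (\sum_(n < N) a n * z ^+ n) <= Num.sqrt S * c^-1.
  apply: (@le_trans _ _ (\sum_(n < N) rnorm (a n * z ^+ n))).
    elim/big_ind2 : _ => // [|x x' y y' xx' yy']; first by rewrite rnorm0.
    by apply: le_trans (ler_rnormD _ _) _; exact: lerD.
  apply: (@le_trans _ _ (\sum_(n < N) Num.sqrt S * r ^+ n)).
    by apply: ler_sum => n _; rewrite rnormM rnormX ler_wpM2r ?exprn_ge0// aS.
  by rewrite -mulr_sumr ler_wpM2l ?sqrtr_ge0.
rewrite (le_trans (lerXn2r 2 _ _ le1)) ?nnegrE ?rnorm_ge0//.
  by rewrite mulr_ge0 ?sqrtr_ge0// invr_ge0 ltW.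
by rewrite exprMn sqr_sqrtr// exprVn mulrC.
Qed.

Lemma measurable_rnorm_le (r : R) :
  measurable ([set z | rnorm (z : R[i]) <= r] : set (borelC R)).
Proof.
have mn : measurable_fun setT (fun z : borelC R => rnorm (z : R[i])).
  apply: lipschitz_measurable => z w.
  have h (u v : R[i]) : rnorm u - rnorm v <= rnorm (u - v).
    by rewrite lerBlDr -{1}(subrK v u) ler_rnormD.
  have hzw := h z w; have hwz := h w z.
  have e : rnorm (z - w) = rnorm (w - z) by rewrite /rnorm distrC.
  by rewrite ler_norml; apply/andP; split; lra.
rewrite (_ : mkset _ = setT `&` (fun z : borelC R => rnorm (z : R[i])) @^-1` `]-oo, r]).
  exact: mn.
by rewrite setTI; apply/seteqP; split=> z /=; rewrite in_itv.
Qed.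

Lemma unit_diskE (z : R[i]) : unit_disk R z <-> rnorm z < 1.
Proof. by rewrite /unit_disk/= -rnorm_eq -(ltcR _ 1). Qed.

Lemma measurable_unit_disk : measurable (unit_disk R).
Proof.
apply: open_borelC; apply: open_complex => z /unit_diskE z1.
exists (1 - rnorm z); first by rewrite subr_gt0.
move=> w wz; apply/unit_diskE; rewrite -(subrK z w).
by apply: le_lt_trans (ler_rnormD _ _) _; lra.
Qed.

Lemma measurable_closed_unit_disk : measurable (closed_unit_disk R).
Proof.
rewrite -[X in measurable X]setCK; apply: measurableC; apply: open_borelC.
by apply: closed_openC; exact: closed_closure.
Qed.

Lemma measurable_unit_circle : measurable (unit_circle R).
Proof.
by apply: measurableD; [exact: measurable_closed_unit_disk|exact: measurable_unit_disk].
Qed.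

End disks.

Section spectral_estimates.
Context (R : realType) (H : completeNormedModType R[i]).
Variable dot : {dot H for Num.conj}.
Hypothesis H_norm : hilbert_norm dot.
Variables (A : {linear H -> H})
  (mu_ : option nat -> {finite_measure set (borelC R) -> \bar R})
  (U : H -> option nat * nat -> borelC R -> borelC R).
Hypothesis U_unitary : unitary_to_model mu_ U.
Hypothesis U_A : forall f, model_eq mu_ (U (A f)) (mul_by_z (U f)).

Section bessel_density.
Hypothesis mu_closed_disk : forall j, mu_ j (~` closed_unit_disk R) = 0%E.
Hypothesis mu_circle : forall B, measurable B -> arc_length R B = 0%E ->
  forall j, mu_ j (B `&` unit_circle R) = 0%E.

(** Suppose that the null sets of all the [mu_j] are null for [m]: then [m] is
    carried by the closed disk and absolutely continuous on the circle. It is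
    exhausted by sets on which the polynomials are bounded in L^2 by
    the square sum of their coefficients. Such a set consists of a smaller disk
    and of a part of the circle where the density is bounded. *)
Lemma bessel_exhaustion (m : {finite_measure set (borelC R) -> \bar R}) :
  (forall B, measurable B -> (forall j, mu_ j B = 0%E) -> m B = 0%E) ->
  exists T : nat -> set (borelC R),
    [/\ forall k, measurable (T k),
        m (~` T k) @[k --> \oo] --> 0%E
      & forall k, exists2 beta, 0 < beta & forall N (a : nat -> R[i]),
        (\int[m]_(z in T k) (rnorm (\sum_(n < N) a n * (z : R[i]) ^+ n) ^+ 2)%:E
         <= (beta * \sum_(n < N) rnorm (a n) ^+ 2)%:E)%E].
Proof.
move=> m_null.
have mC := @measurable_unit_circle R.
have moo (B : set (borelC R)) : measurable B -> (m B < +oo)%E.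
  by move=> mB; rewrite ltey_eq fin_num_measure.
have [arc arcE arcint] := arc_length_finite_measure R.
pose nu : {finite_measure set (borelC R) -> \bar R} := mfrestr mC (moo _ mC).
have nu_arc : nu `<< arc.
  apply/null_content_dominatesP => B mB arcB.
  apply: m_null; first exact: measurableI.
  by apply: mu_circle; rewrite // -arcE.
have [S [mS ndS SU Sbound]] := Radon_Nikodym_exhaustion nu_arc.
pose K k : set (borelC R) := [set z | rnorm (z : R[i]) <= 1 - k.+1%:R^-1].
have mK k : measurable (K k) by exact: measurable_rnorm_le.
have mCS k : measurable (unit_circle R `&` S k) by exact: measurableI.
exists (fun k => K k `|` (unit_circle R `&` S k)); split.
- by move=> k; exact: measurableU.
- pose V k := ~` (K k `|` (unit_circle R `&` S k)).
  have mV k : measurable (V k) by apply/measurableC/measurableU.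
  have mVI : measurable (\bigcap_k V k) by exact: bigcapT_measurable.
  suff V0 : m (\bigcap_k V k) = 0%E.
    rewrite -V0; apply: (nonincreasing_cvg_mu (moo _ (mV 0%N)) mV mVI).
    move=> k l kl; apply/subsetPset; apply: subsetC; apply: setUSS.
      move=> z; rewrite /K/= => /le_trans; apply; rewrite lerD2l lerN2.
      by rewrite lef_pV2 ?posrE// ler_nat.
    by apply: setIS; exact/subsetPset/ndS.
  have mD : measurable (~` closed_unit_disk R).
    by apply: measurableC; exact: measurable_closed_unit_disk.
  apply/eqP; rewrite eq_le measure_ge0 andbT -[leRHS](m_null _ mD mu_closed_disk).
  rewrite le_measure ?inE//.
  move=> z Vz Dz; have [Uz|/negP Uz] := boolP `[< unit_disk R z >].
    have /unit_diskE z1 : unit_disk R z by apply/asboolP.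
    have z0 : 0 < 1 - rnorm (z : R[i]) by rewrite subr_gt0.
    have [k kz] : exists k, k.+1%:R^-1 < 1 - rnorm (z : R[i]).
      have [k _ /(_ k (leqnn k)) ?] := near_infty_natSinv_lt (PosNum z0).
      by exists k.
    by apply: (Vz k) => //; left; rewrite /K/=; rewrite lerBrDr addrC -lerBrDr ltW.
  have [k _ Skz] : (\bigcup_k S k) z by rewrite SU.
  apply: (Vz k) => //; right; split=> //; split=> // Uz'; apply: Uz; exact/asboolP.
(* The first term bounds the integral over the disk and the second one the
   integral over the circle; adding 1 makes the constant positive. *)
move=> k; exists (k.+1%:R ^+ 2 * fine (m setT) + k%:R * (2 * pi) + 1).
  rewrite ltr_wpDl// addr_ge0 ?mulr_ge0 ?sqr_ge0 ?fine_ge0//.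
  by rewrite pi_ge0.
move=> N a; pose P (z : borelC R) := rnorm (\sum_(n < N) a n * (z : R[i]) ^+ n) ^+ 2.
pose SS := \sum_(n < N) rnorm (a n) ^+ 2.
have SS0 : 0 <= SS by apply: sumr_ge0 => n _; exact: sqr_ge0.
have mP : measurable_fun setT (fun z : borelC R => (P z)%:E).
  exact: measurable_rnorm2E (measurable_complex_poly N a).
have P0 z : (0 <= (P z)%:E)%E by rewrite lee_fin sqr_ge0.
have bK : (\int[m]_(z in K k) (P z)%:E <= (k.+1%:R ^+ 2 * SS * fine (m setT))%:E)%E.
  apply: (@le_trans _ _ (\int[m]_(z in K k) (k.+1%:R ^+ 2 * SS)%:E)%E).
    apply: ge0_le_integral => //; first exact: measurable_funTS.
    move=> z /(sqr_rnorm_poly_le N a) h; rewrite lee_fin.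
    by move: h; rewrite invr_gt0 ltr0n exprVn invrK; apply.
  rewrite integral_cst// [leRHS]EFinM fineK ?fin_num_measure//.
  rewrite lee_wpmul2l ?lee_fin ?mulr_ge0 ?sqr_ge0//.
  by rewrite le_measure ?inE.
have bC : (\int[m]_(z in unit_circle R `&` S k) (P z)%:E <= (k%:R * (2 * pi * SS))%:E)%E.
  have -> : (\int[m]_(z in unit_circle R `&` S k) (P z)%:E =
             \int[nu]_(z in S k) (P z)%:E)%E.
    rewrite integral_mkcondr [RHS]integral_mkcond ge0_integral_mrestr//.
      apply/(measurable_restrictT _ _).1 => //; exact: measurable_funTS.
    by move=> z; apply: erestrict_ge0.
  by apply: le_trans (Sbound k _ mP P0) _; rewrite arcint -EFinM.
rewrite integral_mkcond.
apply: (@le_trans _ _ (\int[m]_z (((fun z => (P z)%:E) \_ (K k)) z +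
   ((fun z => (P z)%:E) \_ (unit_circle R `&` S k)) z))%E).
  apply: ge0_le_integral => //.
  - by move=> z _; apply: erestrict_ge0 => t _; exact: P0.
  - apply/(measurable_restrictT _ _).1; first exact: measurableU.
    exact: measurable_funTS.
  - apply: emeasurable_funD; apply/(measurable_restrictT _ _).1 => //;
    exact: measurable_funTS.
  move=> z _; rewrite !patchE in_setU.
  by case: (z \in K k) => /=; [rewrite leeDl//; case: ifP|rewrite add0e].
rewrite ge0_integralD//; last 4 first.
- by move=> z _; apply: erestrict_ge0 => t _; exact: P0.
- by apply/(measurable_restrictT _ _).1 => //; exact: measurable_funTS.
- by move=> z _; apply: erestrict_ge0 => t _; exact: P0.
- by apply/(measurable_restrictT _ _).1 => //; exact: measurable_funTS.
rewrite -!integral_mkcond; apply: le_trans (leeD bK bC) _.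
by rewrite -EFinD lee_fin -/SS; lra.
Qed.

(** The spectral truncations of [f] to the sets above have Bessel orbits and
    approximate [f]. *)
Lemma bessel_vectors_dense f (eps : R) : 0 < eps ->
  exists2 g, rnorm (f - g) < eps &
    exists2 beta : R, 0 < beta & bessel_vector A beta g.
Proof.
move=> eps0; have [m m_null m_norm] := spectral_measure_ex U_unitary f.
have [T [mT T0 Tb]] := bessel_exhaustion m_null.
have mTC k : measurable (~` T k) by exact: measurableC.
have [k Tk] : exists k, (m (~` T k) < (eps ^+ 2)%:E)%E.
  move/fine_cvg : T0 => /cvgrPdist_lt /(_ _ (exprn_gt0 2 eps0)) [k _ /(_ k (leqnn k))].
  rewrite /= sub0r normrN ger0_norm ?fine_ge0// => mk; exists k.
  by rewrite -(fineK (fin_num_measure m _ (mTC k))) lte_fin.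
have [beta beta0 bT] := Tb k.
pose psi (z : borelC R) : R[i] := (\1_(T k) z)%:C%C.
have mpsi : measurable_fun setT (psi : borelC R -> borelC R).
  by apply: measurable_real_complex; exact: measurable_indic.
have [|g fg] := multiple_ex U_unitary f mpsi.
  by move=> z; rewrite /psi rnorm_real indicE normr_nat; case: (_ \in _).
have mpsi1 : measurable_fun setT (fun z => -1 * psi z + 1 : borelC R).
  apply: (measurable_complexD (f := fun z => -1 * psi z)); last exact: measurable_cst.
  by apply: (measurable_complexM (f := fun=> -1)) => //; exact: measurable_cst.
exists g.
  have e : f - g = -1 *: g + f by rewrite scaleN1r addrC.
  rewrite -(@ltr_pXn2r _ 2) ?nnegrE ?rnorm_ge0 ?ltW// -lte_fin e.
  rewrite -(m_norm _ _ _ (multiple_lin U_unitary (-1) fg (@multiple1 _ _ mu_ U f))).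
    apply: le_lt_trans Tk.
    rewrite -[X in m X]setIT -(integral_indic m measurableT)//.
    apply: ge0_le_integral => //.
    - by move=> z _; rewrite lee_fin sqr_ge0.
    - exact: measurable_rnorm2E mpsi1.
    - exact/measurable_EFinP/measurable_indic.
    move=> z _; rewrite lee_fin /psi !indicE in_setC.
    case: (z \in T k) => /=.
      by rewrite mulr1 addNr rnorm0 expr0n.
    by rewrite mulr0 add0r (rnorm_real 1) normr1 expr1n.
  exact: mpsi1.
have mP N (a : nat -> R[i]) : measurable_fun setT
    (fun z : borelC R => (\sum_(n < N) a n * (z : R[i]) ^+ n) * psi z : borelC R).
  by apply: measurable_complexM => //; exact: measurable_complex_poly.
exists beta => // N a; rewrite -lee_fin.
have := multiple_polyA U_unitary U_A N a fg.
move=> /(m_norm _ _) <-; last first.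
  exact: mP.
apply: le_trans (bT N a); rewrite [leRHS]integral_mkcond.
apply: ge0_le_integral => //.
- by move=> z _; rewrite lee_fin sqr_ge0.
- exact: measurable_rnorm2E (mP N a).
- apply/(measurable_restrictT _ _).1 => //; apply: measurable_funTS.
  exact: measurable_rnorm2E (measurable_complex_poly N a).
move=> z _; rewrite patchE /psi indicE; case: (z \in T k) => /=.
  by rewrite mulr1.
by rewrite mulr0 rnorm0 expr0n.
Qed.

End bessel_density.
Section defect.
Hypothesis mu_disk : forall j, mu_ j (~` unit_disk R) = 0%E.

(** The square root vanishes on negative numbers, so [w] is bounded by 1 on the
    whole plane. *)
Let w (z : borelC R) : R := Num.sqrt (1 - rnorm (z : R[i]) ^+ 2).

Let measurable_w : measurable_fun setT w.
Proof.
apply: (measurableT_comp (f := @Num.sqrt R)).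
  exact: continuous_measurable_fun (@sqrt_continuous R).
apply: measurable_funB; first exact: measurable_cst.
exact: (measurable_rnorm2 (f := id)).
Qed.

Lemma defect_ex f : exists x, multiple mu_ U (fun z => (w z)%:C%C) f x.
Proof.
apply: multiple_ex => //; first exact: measurable_real_complex.
move=> z; rewrite rnorm_real ger0_norm ?sqrtr_ge0//.
by rewrite -[leRHS]sqrtr1 ler_wsqrtr// gerBl sqr_ge0.
Qed.

(** The defect operator [D], the square root of [I - A* A], given by
    multiplication by [w] in the model. *)
Definition defect f : H := projT1 (cid (defect_ex f)).

Lemma defectP f : multiple mu_ U (fun z => (w z)%:C%C) f (defect f).
Proof. exact: projT2 (cid (defect_ex f)). Qed.

Lemma sqr_rnorm_defect f x : multiple mu_ U (fun z => (w z)%:C%C) f x ->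
  rnorm x ^+ 2 = rnorm f ^+ 2 - rnorm (A f) ^+ 2.
Proof.
move=> fx; have [m m_null m_norm] := spectral_measure_ex U_unitary f.
have mW : measurable_fun setT (fun z => (w z)%:C%C : borelC R).
  exact: measurable_real_complex.
have mz : measurable_fun setT (fun z : borelC R => (z : R[i]) * 1 : borelC R).
  by apply: measurable_complexM => //; exact: measurable_cst.
have xE := m_norm _ _ mW fx.
have AE := m_norm _ _ mz (multiple_A U_A (@multiple1 _ _ mu_ U f)).
have fE := m_norm (fun=> 1) f (measurable_cst _) (@multiple1 _ _ mu_ U f).
have mD0 : m (~` unit_disk R) = 0%E.
  by apply: m_null => //; apply: measurableC; exact: measurable_unit_disk.
have : ((rnorm x ^+ 2)%:E + (rnorm (A f) ^+ 2)%:E = (rnorm f ^+ 2)%:E)%E.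
  rewrite -xE -AE -fE -ge0_integralD//; last 4 first.
  - by move=> z _; rewrite lee_fin sqr_ge0.
  - exact: measurable_rnorm2E mW.
  - by move=> z _; rewrite lee_fin sqr_ge0.
  - exact: measurable_rnorm2E mz.
  apply: ge0_ae_eq_integral => //.
  - by apply: emeasurable_funD; [exact: measurable_rnorm2E mW|exact: measurable_rnorm2E mz].
  - by move=> z _; rewrite -EFinD lee_fin addr_ge0 ?sqr_ge0.
  - by move=> z _; rewrite lee_fin sqr_ge0.
  exists (~` unit_disk R); split=> //.
    by apply: measurableC; exact: measurable_unit_disk.
  apply: subsetC => z /unit_diskE z1 _ /=; rewrite -EFinD; congr (_%:E).
  rewrite mulr1 rnorm_real real_normK ?num_real// sqr_sqrtr; last first.
    by rewrite subr_ge0 exprn_ile1 ?rnorm_ge0// ltW.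
  by rewrite subrK (rnorm_real 1) normr1 expr1n.
by rewrite -EFinD => -[<-]; rewrite addrK.
Qed.

(** Dominated convergence: [|z|^(2n)] tends to 0 on the open disk. *)
Lemma iter_cvg0 f : rnorm (iter n A f) ^+ 2 @[n --> \oo] --> (0 : R).
Proof.
have [m m_null m_norm] := spectral_measure_ex U_unitary f.
have mz n : measurable_fun setT (fun z : borelC R => (z : R[i]) ^+ n * 1 : borelC R).
  apply: measurable_complexM; last exact: measurable_cst.
  exact: (measurable_complexX (f := id)).
have AE n := m_norm _ _ (mz n) (multiple_iterA U_A n (@multiple1 _ _ mu_ U f)).
have mD : measurable (unit_disk R) by exact: measurable_unit_disk.
have mD0 : m (~` unit_disk R) = 0%E by apply: m_null => //; exact: measurableC.
apply: (@fine_cvg _ _ _ _ (fun n => (rnorm (iter n A f) ^+ 2)%:E)).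
under eq_fun do rewrite -AE.
have [|||||_ _] := @dominated_convergence _ _ _ m _ measurableT
  (fun n (z : borelC R) => (rnorm ((z : R[i]) ^+ n * 1) ^+ 2)%:E) (cst 0%E) (cst 1%E).
- by move=> n; exact: measurable_rnorm2E (mz n).
- exact: measurable_cst.
- exists (~` unit_disk R); split=> //; first exact: measurableC.
  apply: subsetC => z /unit_diskE z1 _ /=.
  apply: cvg_EFin; first exact: nearW.
  have : `|rnorm (z : R[i]) ^+ 2| < 1.
    by rewrite ger0_norm ?sqr_ge0// exprn_ilt1 ?rnorm_ge0.
  move=> /cvg_expr; apply: cvg_trans; apply: near_eq_cvg; apply: nearW => n /=.
  by rewrite mulr1 rnormX exprAC.
- by apply: finite_measure_integrable_cst.
- exists (~` unit_disk R); split=> //; first exact: measurableC.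
  apply: subsetC => z /unit_diskE z1 n _ /=.
  rewrite lee_fin mulr1 rnormX ger0_norm ?sqr_ge0//.
  by rewrite !exprn_ile1 ?exprn_ge0 ?rnorm_ge0// ltW.
by rewrite integral0.
Qed.

(** If [D u = 0] then [A] preserves the norms of all [A^n u], since [D A^n u = 0]
    too; these norms tend to 0, so [u = 0]. *)
Lemma defect_inj : injective defect.
Proof.
move=> f g fg; apply/eqP; rewrite -subr_eq0; apply/eqP/rnorm_eq0.
have u0 : multiple mu_ U (fun z => (w z)%:C%C) (f - g) 0.
  have := multiple_linr U_unitary (-1) (defectP g) (defectP f).
  by rewrite fg !scaleN1r addNr addrC.
have un n : multiple mu_ U (fun z => (w z)%:C%C) (iter n A (f - g)) 0.
  elim: n => // n IH p cp.
  have := U_A 0 cp; have := U_A (iter n A (f - g)) cp; have := IH p cp.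
  rewrite linear0; apply: filterS3 => z h1 h2 ->.
  by rewrite /mul_by_z h1 /= h2 /mul_by_z mulrCA.
have const n : rnorm (iter n A (f - g)) ^+ 2 = rnorm (f - g) ^+ 2.
  elim: n => // n <-; have := sqr_rnorm_defect (un n).
  by rewrite rnorm0 expr0n /= => /esym/eqP; rewrite subr_eq0 => /eqP.
have := iter_cvg0 (f - g).
rewrite (_ : (fun n => _) = cst (rnorm (f - g) ^+ 2)); last exact/funext.
move=> /cvg_lim; rewrite lim_cst// => /(_ (@Rhausdorff R))/eqP.
by rewrite sqrf_eq0 => /eqP.
Qed.

Lemma defect_selfadjoint f g : dot f (defect g) = dot (defect f) g.
Proof.
have re u v x y := @real_multiple_selfadjoint_re _ _ _ H_norm _ _ U_unitary
  w u v x y measurable_w.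
(* The imaginary parts of <f, D g> are real parts for ['i f]. *)
have fi : multiple mu_ U (fun z => (w z)%:C%C) ('i%C *: f + 0) ('i%C *: defect f + 0).
  apply: multiple_linr => //; first exact: defectP.
  move=> p cp; have := multiple0 U_unitary 0 cp.
  by apply: filterS => z ->; rewrite mul0r mulr0.
have h1 := re _ _ _ _ (defectP f) (defectP g).
have := re _ _ _ _ fi (defectP g).
move: h1; rewrite !addr0 /redot !dotZl.
case: (dot f _) => a b; case: (dot _ g) => c d /=.
by rewrite !mul0r !mul1r !sub0r => -> /oppr_inj ->.
Qed.

End defect.
End spectral_estimates.

Theorem theorem5p2 (R : realType) (H : completeNormedModType R[i])
    (dot : {dot H for Num.conj})
    (H_norm : hilbert_norm dot)
    (H_infdim : infinite_dimensional H)
    (H_sep : separable_space H)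
    (A : {linear H -> H})
    (A_bounded : bounded_operator A)
    (A_normal : normal_operator dot A)
    (mu : {measure set (borelC R) -> \bar R})
    (mu_A : scalar_spectral_measure A mu) :
  (mu (~` closed_unit_disk R) = 0%E ->
   (fun B : set (borelC R) => mu (B `&` unit_circle R)) `<< arc_length R ->
   exists G : set H,
     [/\ countable G,
         complete_family (orbit_index G) (orbit_family A)
       & bessel dot (orbit_index G) (orbit_family A)]) /\
  (mu (~` unit_disk R) = 0%E ->
   exists G : set H,
     countable G /\ parseval_frame dot (orbit_index G) (orbit_family A)).
Proof.
have [mu_ [U [_ _ U_unitary U_A muE]]] := mu_A.
have mu_null B : measurable B -> mu B = 0%E -> forall j, mu_ j B = 0%E.
  by move=> mB; rewrite muE// => /esum_eq0; apply.
split=> [mu_closed mu_arc|mu_disk].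
  apply: (complete_bessel_orbits H_norm) => // f eps.
  apply: (bessel_vectors_dense U_unitary U_A).
    by apply: mu_null => //; apply: measurableC; exact: measurable_closed_unit_disk.
  move=> B mB arcB; apply: mu_null.
    by apply: measurableI => //; exact: measurable_unit_circle.
  have [arc arcE _] := arc_length_finite_measure R.
  apply: (mu_arc B) => // B' mB' B'B; rewrite -arcE.
  by apply/eqP; rewrite eq_le measure_ge0 andbT -[leRHS]arcB -arcE le_measure ?inE.
have mu_j : forall j, mu_ j (~` unit_disk R) = 0%E.
  by apply: mu_null => //; apply: measurableC; exact: measurable_unit_disk.
have [B AB normalA] := A_normal.
apply: (parseval_orbits H_norm AB normalA (D := defect U_unitary)) => //.
- exact: defect_selfadjoint.
- by move=> f; apply: (sqr_rnorm_defect U_unitary U_A mu_j); exact: defectP.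
- exact: defect_inj.
- exact: (iter_cvg0 U_unitary U_A mu_j).
Qed.
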